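(* Let $K$ be a field of characteristic $p$, and let $f\in K[X,Y,Z]$ be an irreducible polynomial of degree $d$, with $d$ not a multiple of $p$. Let $f_d$ be its homogeneous component of maximal degree, and suppose that there is a polynomial $g(X,Y,Z)\in K[X,Y,Z]$ such that: (1) $f_d$ is irreducible; (2) $f_d(X,Y,Z)=X^d+g(X,Y,Z)$; (3) $g(X,Y,Z)\neq 0$ and $g$ has a linear factor $g_1\neq X$; (4) if $g_1$ is such a factor, then $\overline{V}(g_1)\cap\overline{V}(g/g_1)\cap\overline{V}(f_d)=\emptyset$. Then $\dim\mathcal{R}(K[X,Y,Z]/(f))=2$.
   Context: For an integral domain $D$ with quotient field $Q(D)$, the reciprocal complement $\mathcal{R}(D)$ is the subring of $Q(D)$ generated by all $1/x$ with $x\in D\setminus\{0\}$; $\dim$ denotes Krull dimension. For homogeneous polynomials $h\in K[X,Y,Z]$, $\overline{V}(h)$ denotes the zero set of $h$ in $\mathbb{P}^2_K$, whose points are the points $[a:b:c]$ with coordinates in an algebraic closure $\overline{K}$ of $K$ (up to scaling), up to the action of the $K$-automorphisms of $\overline{K}$. *)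

(* Defs.v *)
From HB Require Import structures.
From mathcomp Require Import all_boot all_algebra.
From mathcomp Require Import boolp classical_sets.
From mathcomp Require Import mpoly.

Set Implicit Arguments.
Unset Strict Implicit.
Unset Printing Implicit Defensive.

Import GRing.Theory.
Local Open Scope ring_scope.

Definition characteristic (K : fieldType) (p : nat) : Prop :=
  if p is 0 then [pchar K] =i pred0 else p \in [pchar K].

Definition irreducible (A : idomainType) (a : A) : Prop :=
  [/\ a != 0, a \isn't a GRing.unit
    & forall b c : A, a = b * c -> b \is a GRing.unit \/ c \is a GRing.unit].

(* D, together with the projection pi, is the quotient ring A / (a). *)
Definition is_quotient_by (A D : comNzRingType) (a : A) (pi : {rmorphism A -> D}) :
    Prop :=
  (forall y : D, exists x : A, pi x = y) /\
  (forall x : A, pi x = 0 <-> exists q : A, x = q * a).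

Section ReciprocalComplement.
Variable D : idomainType.

Definition recip_gen (q : {fraction D}) : Prop :=
  forall S : {pred {fraction D}}, subring_closed S ->
    (forall x : D, x != 0 -> (FracField.tofrac x)^-1 \in S) -> q \in S.

Definition recip_pred : {pred {fraction D}} := fun q => `[< recip_gen q >].

Lemma recip_subring_closed : subring_closed recip_pred.
Proof.
split=> [|u v /asboolP hu /asboolP hv|u v /asboolP hu /asboolP hv].
- by apply/asboolP => S [].
- by apply/asboolP => S hS hx; case: (hS) => _ hB _; apply: hB;
    [exact: hu | exact: hv].
- by apply/asboolP => S hS hx; case: (hS) => _ _ hM; apply: hM;
    [exact: hu | exact: hv].
Qed.

HB.instance Definition _ :=
  GRing.isSubringClosed.Build {fraction D} recip_pred recip_subring_closed.

Record recip_compl : Type := RecipCompl {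
  recip_val : {fraction D};
  recip_valP : recip_val \in recip_pred }.

HB.instance Definition _ := [isSub for recip_val].
HB.instance Definition _ := [Choice of recip_compl by <:].
HB.instance Definition _ := [SubChoice_isSubComNzRing of recip_compl by <:].

End ReciprocalComplement.

(* [idealr_closed] includes properness (1 \notin P). Boolean predicates lose no
   ideals: by the axioms of boolp, every subset of A is of this form. *)
Definition prime_ideal (A : comNzRingType) (P : {pred A}) : Prop :=
  idealr_closed P /\ prime_idealr_closed P.

(* P 0 < P 1 < ... < P n; values of P beyond n are irrelevant. *)
Definition prime_chain (A : comNzRingType) (n : nat) (P : nat -> {pred A}) : Prop :=
  (forall i, (i <= n)%N -> prime_ideal (P i)) /\
  (forall i, (i < n)%N ->
     {subset P i <= P i.+1} /\ ~ {subset P i.+1 <= P i}).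

Definition has_krull_dim (A : comNzRingType) (n : nat) : Prop :=
  (exists P, @prime_chain A n P) /\
  (forall m P, @prime_chain A m P -> (m <= n)%N).

Definition is_algebraic_closure (K : fieldType) (L : closedFieldType)
    (iota : {rmorphism K -> L}) : Prop :=
  forall x : L, algebraicOver iota x.

Section ProjectivePlane.
Variables (K : fieldType) (L : closedFieldType) (iota : {rmorphism K -> L}).
Local Open Scope classical_set_scope.

(* Two coordinate vectors name the same point of P^2_K when they agree up to
   scaling and up to a K-automorphism of L. *)
Definition same_point (v w : 'rV[L]_3) : Prop :=
  exists c : L, exists sigma : {rmorphism L -> L},
    [/\ c != 0, bijective sigma, (forall a : K, sigma (iota a) = iota a)
      & w = c *: map_mx sigma v].

(* The points of P^2_K are the classes of nonzero coordinate vectors. *)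
Definition P2 : set (set 'rV[L]_3) :=
  [set P | exists2 v : 'rV[L]_3, v != 0 & P = [set w | same_point v w]].

(* Only meaningful for homogeneous h, for which vanishing does not depend on
   the representative v. *)
Definition Vbar (h : {mpoly K[3]}) : set (set 'rV[L]_3) :=
  [set P | P2 P /\
    forall v : 'rV[L]_3, P v -> (map_mpoly iota h).@[fun i => v 0 i] = 0].

End ProjectivePlane.

(* Main.v *)
From HB Require Import structures.
Require Import Defs.
From mathcomp Require Import all_boot all_order all_algebra.
From mathcomp Require Import boolp classical_sets.
From mathcomp Require Import mpoly ring zify.

Set Implicit Arguments.
Unset Strict Implicit.
Unset Printing Implicit Defensive.

Import GRing.Theory.
Local Open Scope ring_scope.

(** Write D = K[X,Y,Z]/(f) and R(D) for its reciprocal complement.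

    The dimension is at most 2 because R(D) is a K-algebra contained in the
    fraction field of D, which has transcendence degree 2.  A chain of four
    primes would give three elements satisfying no polynomial relation over K:
    the lexicographically first coefficient of a relation would be a unit lying
    in the last prime [prime_chain_independent].  But any three fractions do
    satisfy a relation [fraction_dependence]: after clearing denominators, the
    N^3 monomials with exponents below N lie in the image in D of the
    polynomials of degree O(N), whose dimension is only O(N^2) because the
    multiples of f vanish there.

    For the lower bound, take linear coordinates X, c = g1 and Z.  The line
    g1 = 0 at infinity meets the curve X^d + g1 g2 = 0 only at the point
    X = g1 = 0, and by the hypothesis on the loci at infinity g2 does not
    vanish at that point.  Regard c as a constant.  The remaining equation in X
    and Z has top form X^d, and the coefficient of Z^(d-1) is a nonzero
    polynomial -b in c.  Give X the weight d-1 and Z the weight d: then the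
    leading form of f is X^d - b Z^(d-1).  As d-1 and d are coprime, the plane
    curve over K(c) has a single branch at infinity, along which X ~ b T^(d-1)
    and Z ~ b T^d.  Hence every nonzero element of D has a pole order w >= 0
    along this branch, with a nonzero leading value in K[c], whose degree is
    again >= 0.  The pair (pole order, degree of the leading value), ordered
    lexicographically, is thus the opposite of a valuation of rank 2 whose ring
    contains all reciprocals of elements of D, that is, contains R(D).  Its two
    nonzero primes contract to primes P1 and P2 of R(D); 1/Z lies in P1, and
    1/c lies in P2 but not in P1, so that 0 < P1 < P2 is a strict chain
    [leading_prime_chain, branch_prime_chain, prime_chain_in_coords].

    A factor g1 proportional to X is compatible with the irreducibility of f_d
    only if d = 1; then f is a hyperplane and other coordinates are used
    [prime_chain_hyperplane]. *)

(** * Primes of the reciprocal complement from degree comparisons *)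

Lemma recip_inv (D : idomainType) (x : D) :
  x != 0 -> (FracField.tofrac x)^-1 \in @recip_pred D.
Proof. by move=> x0; apply/asboolP => S _; apply. Qed.

Section DegreeComparison.
Variable D : idomainType.
Local Notation "x %:F" := (@FracField.tofrac D x).

Lemma fraction_repr (q : {fraction D}) :
  exists x y : D, y != 0 /\ q = x%:F / y%:F.
Proof.
elim/quotW: q => r; exists (frac r).1, (frac r).2.
have nz := denom_ratioP r; split=> //.
apply: (canRL (mulfK _)); first by rewrite tofrac_eq0.
unlock FracField.tofrac; rewrite -[LHS]FracField.pi_mul; apply/eqmodP.
rewrite /= FracField.equivfE /FracField.mulf /=.
by rewrite !numden_Ratio ?mulr1 ?oner_neq0 ?nz // mulrC.
Qed.

Lemma fraction_eq (x y s t : D) :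
  y != 0 -> t != 0 -> (x%:F / y%:F == s%:F / t%:F) = (x * t == s * y).
Proof.
by move=> y0 t0; rewrite eqr_div ?tofrac_eq0 // -!tofracM tofrac_eq.
Qed.

(** Encodes a valuation of the fraction field that is nonpositive on nonzero
    elements of D by the comparison of degrees (opposite values) on D; this
    way valuations of any rank are treated without a value group. *)
Record degree_comparison (le : rel D) : Prop := DegreeComparison {
  dle_total : total le;
  dle_trans : transitive le;
  dle_add : forall x y z, le x z -> le y z -> le (x + y) z;
  dle_mul : forall x y z, z != 0 -> le (x * z) (y * z) = le x y;
  dle_ge1 : forall y, y != 0 -> le 1 y;
  dle_x0 : forall x, le x 0 = (x == 0) }.

Variables (le : rel D) (leP : degree_comparison le).

Lemma dle_refl x : le x x.
Proof. by case/orP: (dle_total leP x x). Qed.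

Lemma dle_0x x : le 0 x.
Proof.
by case/orP: (dle_total leP 0 x) => //; rewrite (dle_x0 leP) => /eqP->; apply: dle_refl.
Qed.

Lemma dle_mulr x y z : le x y -> le (x * z) (y * z).
Proof.
by have [->|z0] := eqVneq z 0; rewrite ?mulr0 ?dle_0x // (dle_mul leP).
Qed.

(** The valuation ring. *)
Definition bounded (q : {fraction D}) : bool :=
  `[< exists x y, [/\ y != 0, q = x%:F / y%:F & le x y] >].

(** The maximal ideal of the valuation ring. *)
Definition small (q : {fraction D}) : bool :=
  `[< exists x y, [/\ y != 0, q = x%:F / y%:F & ~~ le y x] >].

Lemma dle_cross x y s t : y != 0 -> t != 0 -> x * t = s * y ->
  (le x y = le s t) * (le y x = le t s).
Proof.
move=> y0 t0 e; split.
  by rewrite -(dle_mul leP x y t0) e mulrC [y * t]mulrC ![y * _]mulrC (dle_mul leP).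
by rewrite -(dle_mul leP y x t0) e mulrC (dle_mul leP).
Qed.

Lemma boundedE x y : y != 0 -> bounded (x%:F / y%:F) = le x y.
Proof.
move=> y0; apply/asboolP/idP => [[s [t [t0 /eqP]]]|h]; last by exists x, y.
by rewrite fraction_eq // => /eqP/(dle_cross y0 t0)->.
Qed.

Lemma smallE x y : y != 0 -> small (x%:F / y%:F) = ~~ le y x.
Proof.
move=> y0; apply/asboolP/idP => [[s [t [t0 /eqP]]]|h]; last by exists x, y.
by rewrite fraction_eq // => /eqP/(dle_cross y0 t0)->.
Qed.

Lemma in_bounded q : (q \in bounded) = bounded q. Proof. by []. Qed.

(** Boundedness is closed under addition because the comparison is
    ultrametric, and a sign changes no degree. *)
Lemma bounded_subring : subring_closed bounded.
Proof.
split=> [|u v|u v].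
- by rewrite in_bounded -[1]divr1 -tofrac1 boundedE ?oner_neq0 ?dle_refl.
- have [x [y [y0 ->]]] := fraction_repr u; have [s [t [t0 ->]]] := fraction_repr v.
  rewrite !in_bounded !boundedE // => xy st.
  rewrite -mulNr addf_div ?tofrac_eq0 // -tofracN -!tofracM -tofracD boundedE ?mulf_neq0 //.
  apply: (dle_add leP); first exact: dle_mulr.
  rewrite mulNr -mulrN [y * t]mulrC; apply: dle_trans (dle_mulr y st) => //.
  rewrite mulrN; have [->|s0] := eqVneq s 0; first by rewrite mul0r oppr0 dle_0x.
  have [->|yn0] := eqVneq y 0; first by rewrite mulr0 oppr0 dle_0x.
  (* If -1 has degree at least that of 1, multiply by -1 to get the converse. *)
  rewrite -mulN1r -{2}[s * y]mul1r (dle_mul leP) ?mulf_neq0 //.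
  case/orP: (dle_total leP (-1) 1) => // h.
  rewrite -(dle_mul leP _ _ (z := -1)) ?oppr_eq0 ?oner_neq0 //.
  by rewrite mulrNN mulr1 mul1r.
- have [x [y [y0 ->]]] := fraction_repr u; have [s [t [t0 ->]]] := fraction_repr v.
  rewrite !in_bounded !boundedE // => xy st.
  rewrite mulf_div -!tofracM boundedE ?mulf_neq0 //.
  apply: (dle_trans leP) (dle_mulr t xy).
  by rewrite ![x * _]mulrC dle_mulr.
Qed.

Lemma recip_bounded (q : recip_compl D) : bounded (val q).
Proof.
case: q => q /= /asboolP h; rewrite -in_bounded; apply: h; first exact: bounded_subring.
move=> x x0; rewrite in_bounded -div1r -tofrac1 boundedE //; exact: (dle_ge1 leP).
Qed.

(** The contraction to the reciprocal complement of the maximal ideal of the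
    valuation ring: by [recip_bounded] the reciprocal complement lies in that
    ring. *)
Definition centre : {pred recip_compl D} := fun q => small (val q).

Lemma in_centre q : (q \in centre) = small (val q). Proof. by []. Qed.

Lemma small_mul u v : bounded u -> small v -> small (u * v).
Proof.
have [x [y [y0 ->]]] := fraction_repr u; have [s [t [t0 ->]]] := fraction_repr v.
rewrite boundedE // smallE // mulf_div -!tofracM smallE ?mulf_neq0 // => xy.
apply: contra => h; have [s0|s0] := eqVneq s 0.
  move: h; rewrite s0 mulr0 (dle_x0 leP (y * t)) mulf_eq0 (negPf y0) (negPf t0) //.
rewrite -(dle_mul leP _ _ y0) [t * y]mulrC; apply: (dle_trans leP) h _.
by rewrite [s * y]mulrC dle_mulr.
Qed.

Lemma small_add u v : small u -> small v -> small (u + v).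
Proof.
have [x [y [y0 ->]]] := fraction_repr u; have [s [t [t0 ->]]] := fraction_repr v.
rewrite !smallE // addf_div ?tofrac_eq0 // -!tofracM -tofracD smallE ?mulf_neq0 //.
rewrite -(dle_mul leP y x t0) -(dle_mul leP t s y0) [t * y]mulrC => hx hs.
case/orP: (dle_total leP (x * t) (s * y)) => h.
  apply: contra hs => /(dle_trans leP); apply; apply: (dle_add leP) => //; exact: dle_refl.
apply: contra hx => /(dle_trans leP); apply; apply: (dle_add leP) => //; exact: dle_refl.
Qed.

Lemma centre_prime : prime_ideal centre.
Proof.
split; first split.
- by rewrite in_centre /= -[0]divr1 -tofrac0 -tofrac1 smallE ?oner_neq0 // (dle_x0 leP) oner_neq0.
- by rewrite in_centre /= -[1]divr1 -tofrac1 smallE ?oner_neq0 // negbK dle_refl.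
- move=> a u v; rewrite !in_centre /= => hu hv.
  by apply: small_add => //; apply: small_mul => //; apply: recip_bounded.
move=> u v; rewrite !in_centre /=.
have [x [y [y0 ->]]] := fraction_repr (recip_val u).
have [s [t [t0 ->]]] := fraction_repr (recip_val v).
rewrite mulf_div -!tofracM !smallE ?mulf_neq0 // -negb_and; apply: contra => /andP[h1 h2].
apply: (dle_trans leP) (dle_mulr t h1) _.
by rewrite ![x * _]mulrC dle_mulr.
Qed.

End DegreeComparison.

(** * Chains of primes give algebraically independent elements *)

Section PrimeChains.
Variable R : comNzRingType.
Implicit Types P Q : {pred R}.

Lemma ideal_mul Q a u : idealr_closed Q -> u \in Q -> a * u \in Q.
Proof. by case=> Q0 _ QA Qu; rewrite -[_ * _]addr0 QA. Qed.

Lemma ideal_sum Q (I : Type) (r : seq I) (p : pred I) (F : I -> R) :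
  idealr_closed Q -> (forall i, p i -> F i \in Q) -> \sum_(i <- r | p i) F i \in Q.
Proof.
case=> Q0 _ QA QF; elim/big_ind: _ => // u v Qu Qv.
by rewrite -[u]mul1r QA.
Qed.

Lemma ideal_addr Q u v : idealr_closed Q -> v \in Q -> u + v \in Q -> u \in Q.
Proof.
by case=> Q0 _ QA Qv Quv; rewrite -(addrK v u) addrC -mulN1r QA.
Qed.

Lemma prime_notin_exp P x n : prime_ideal P -> x \notin P -> x ^+ n \notin P.
Proof.
case=> [[_ P1 _] PM] Px; elim: n => [|n IH]; first by rewrite expr0.
by rewrite exprS; apply/negP => /PM; rewrite (negPf Px) (negPf IH).
Qed.

(** A power of x factors out of the sum and is outside P; what remains in P is
    the coefficient of index i0 modulo x, and x lies in Q. *)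
Lemma first_coef_mem P Q x N (s : 'I_N -> R) (i0 : 'I_N) :
  prime_ideal P -> idealr_closed Q -> {subset P <= Q} ->
  x \notin P -> x \in Q -> (forall i : 'I_N, (i < i0)%N -> s i = 0) ->
  \sum_i s i * x ^+ i \in P -> s i0 \in Q.
Proof.
move=> Pp Qi PQ xP xQ s0.
have -> : \sum_i s i * x ^+ i
    = x ^+ i0 * (s i0 + \sum_(i : 'I_N | (i0 < i)%N) s i * x ^+ (i - i0)).
  rewrite (bigD1 i0) //= mulrDr mulrC; congr (_ + _).
  rewrite (bigID (fun i : 'I_N => (i < i0)%N)) /= big1 ?add0r; last first.
    by move=> i /andP[_ /s0->]; rewrite mul0r.
  rewrite mulr_sumr; apply: eq_big => [i|i /andP[_ ii]].
    by rewrite -leqNgt [RHS]ltn_neqAle eq_sym.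
  by rewrite mulrCA -exprD subnKC // leqNgt.
case: (Pp) => _ PM /PM; rewrite (negPf (prime_notin_exp _ Pp xP)) /= => /PQ.
apply: ideal_addr => //; apply: ideal_sum => // i ii.
by rewrite -(subnSK ii) exprSr mulrA ideal_mul.
Qed.

Lemma first_index N (p : pred 'I_N) : (exists i, p i) ->
  exists2 i0, p i0 & forall i : 'I_N, (i < i0)%N -> ~~ p i.
Proof.
case=> i pi; case: (arg_minnP (fun i : 'I_N => nat_of_ord i) pi) => i0 pi0 m.
by exists i0 => // j; apply: contraL => /m; rewrite -leqNgt.
Qed.

(** Take in the relation the lexicographically first nonzero coefficient: by
    [first_coef_mem], applied once in each prime, this unit lies in P3. *)
Lemma prime_chain_independent (P : nat -> {pred R}) (x1 x2 x3 : R) N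
    (c : 'I_N -> 'I_N -> 'I_N -> R) :
  prime_chain 3 P ->
  x1 \notin P 0%N -> x1 \in P 1%N -> x2 \notin P 1%N -> x2 \in P 2%N ->
  x3 \notin P 2%N -> x3 \in P 3%N ->
  (forall i j k, c i j k != 0 -> exists u, u * c i j k = 1) ->
  \sum_i \sum_j \sum_k c i j k * x1 ^+ i * x2 ^+ j * x3 ^+ k = 0 ->
  forall i j k, c i j k = 0.
Proof.
case=> Pp Pinc x10 x11 x21 x22 x32 x33 cU rel i j k.
apply: contrapT => /eqP cn0.
have Pid m : (m <= 3)%N -> idealr_closed (P m) by case/Pp.
pose n3 i j := fun k => c i j k != 0.
pose n2 i := fun j => [exists k, n3 i j k].
pose n1 := fun i => [exists j, n2 i j].
have [i0 /existsP/first_index[j0 /existsP/first_index[k0 nk mk] mj] mi] : exists2 i0, n1 i0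
    & forall i : 'I_N, (i < i0)%N -> ~~ n1 i.
  by apply: first_index; exists i; apply/existsP; exists j; apply/existsP; exists k.
have h1 : \sum_j \sum_k c i0 j k * x2 ^+ j * x3 ^+ k \in P 1%N.
  pose s i := \sum_j \sum_k c i j k * x2 ^+ j * x3 ^+ k.
  apply: (first_coef_mem (Pp 0%N isT) (Pid 1%N isT) _ x10 x11 (s := s)) => /=.
  - by case: (Pinc 0%N isT).
  - move=> l /mi /existsPn hl; rewrite /s big1 // => j' _; rewrite big1 // => k' _.
    by move/existsPn: (hl j') => /(_ k'); rewrite negbK => /eqP->; rewrite !mul0r.
  suff -> : \sum_i s i * x1 ^+ i = 0 by case: (Pid 0%N isT).
  rewrite -[RHS]rel; apply: eq_bigr => l _; rewrite mulr_suml; apply: eq_bigr => j' _.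
  by rewrite mulr_suml; apply: eq_bigr => k' _; rewrite mulrAC; congr (_ * _); rewrite mulrAC.
have h2 : \sum_k c i0 j0 k * x3 ^+ k \in P 2%N.
  pose s j := \sum_k c i0 j k * x3 ^+ k.
  apply: (first_coef_mem (Pp 1%N isT) (Pid 2%N isT) _ x21 x22 (s := s)) => /=.
  - by case: (Pinc 1%N isT).
  - move=> l /mj /existsPn hl; rewrite /s big1 // => k' _.
    by move: (hl k'); rewrite negbK => /eqP->; rewrite !mul0r.
  congr (_ \in P 1%N): h1; apply: eq_bigr => l _; rewrite mulr_suml; apply: eq_bigr => k' _.
  by rewrite mulrAC.
have h3 : c i0 j0 k0 \in P 3%N.
  apply: (first_coef_mem (Pp 2%N isT) (Pid 3%N isT) _ x32 x33 (s := c i0 j0)) => /=.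
  - by case: (Pinc 2%N isT).
  - by move=> l /mk; rewrite negbK => /eqP.
  exact: h2.
have [u u1] := cU _ _ _ nk.
case: (Pid 3%N isT) => _ /negP notP1 _; apply: notP1.
by rewrite -u1; apply: ideal_mul (Pid 3%N isT) h3.
Qed.

End PrimeChains.

(** * Three elements of the fraction field are algebraically dependent *)

(** The matrix of A has more rows than columns. *)
Lemma linear_dependence (K : fieldType) (I J : finType) (A : I -> J -> K) :
  (#|J| < #|I|)%N ->
  exists2 u : I -> K, (exists i, u i != 0) & forall j, \sum_i u i * A i j = 0.
Proof.
move=> JI; pose M := \matrix_(i < #|I|, j < #|J|) A (enum_val i) (enum_val j).
have : kermx M != 0.
  rewrite kermx_eq0 /row_free; apply: contraTN JI => /eqP <-.
  by rewrite -leqNgt rank_leq_col.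
case/matrix0Pn => i [j uij]; exists (fun x => kermx M i (enum_rank x)).
  by exists (enum_val j); rewrite enum_valK.
move=> y; have := mulmx_ker M; move/matrixP/(_ i (enum_rank y)); rewrite !mxE; apply: etrans.
rewrite (reindex (@enum_val I predT)) /=; last by apply: onW_bij; exact: enum_val_bij.
by apply: eq_bigr => l _; rewrite !mxE enum_valK enum_rankK.
Qed.

(** A monomial in the shell n - d < degree <= n is determined by its degree
    and two of its three exponents. *)
Lemma card_monomials_shell n d :
  (#|{: 'X_{1..3 < n.+1}}| <= #|{: 'X_{1..3 < n.+1 - d}}| + d * n.+1 ^ 2)%N.
Proof.
have bd (m : 'X_{1..3 < n.+1}) i : (val m i < n.+1)%N.
  rewrite ltnS; apply: leq_trans (_ : mdeg (val m) <= n)%N; last by rewrite -ltnS bmdeg.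
  by rewrite mdegE (bigD1 i) //= leq_addr.
case: d => [|d]; first by rewrite subn0 leq_addr.
pose T := ('X_{1..3 < n.+1 - d.+1} + 'I_d.+1 * ('I_n.+1 * 'I_n.+1))%type.
pose F (m : 'X_{1..3 < n.+1}) : T :=
  if insub (val m) is Some m' then inl m'
  else inr (inord (mdeg (val m) - (n.+1 - d.+1)),
            (inord (val m ord0), inord (val m (inord 1)))).
have Finj : injective F.
  move=> m m'; rewrite /F; case: insubP => [u _ hu|hm]; case: insubP => [u' _ hu'|hm'] // [].
    by move=> uu; apply: val_inj; rewrite -hu -hu' uu.
  move=> e1 e2 e3; apply: val_inj => /=.
  have dm := bmdeg m; have dm' := bmdeg m'.
  move: hm hm'; rewrite -!leqNgt /= => hm hm'.
  have e1' : mdeg (val m) = mdeg (val m').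
    by move/(congr1 (@nat_of_ord _)): e1; rewrite !inordK /=; lia.
  move/(congr1 (@nat_of_ord _)): e2; rewrite (inordK (bd m _)) (inordK (bd m' _)) => e2.
  move/(congr1 (@nat_of_ord _)): e3; rewrite (inordK (bd m _)) (inordK (bd m' _)) => e3.
  apply/mnmP => -[[|[|[|//]]] hi].
  - by rewrite (_ : Ordinal hi = ord0) //; apply: val_inj.
  - by rewrite (_ : Ordinal hi = inord 1) //; apply: val_inj; rewrite /= inordK.
  move: e1'; rewrite !mdegE !big_ord_recl !big_ord0 /=.
  rewrite (_ : lift ord0 ord0 = inord 1); last by apply: val_inj; rewrite /= inordK.
  rewrite (_ : lift ord0 (lift ord0 ord0) = Ordinal hi); last by apply: val_inj.
  by rewrite e2 e3 !addn0 => /addnI/addnI.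
apply: leq_trans (leq_card F Finj) _.
by rewrite card_sum !card_prod !card_ord mulnn.
Qed.

Lemma msizeM_leq n (K : idomainType) (p q : {mpoly K[n]}) :
  (msize (p * q) <= (msize p + msize q).-1)%N.
Proof.
have [->|p0] := eqVneq p 0; first by rewrite mul0r mmeasure0.
have [->|q0] := eqVneq q 0; first by rewrite mulr0 mmeasure0.
by rewrite msizeM.
Qed.

(** The polynomials of degree at most n that are multiples of f already fill
    that space up to a subspace of dimension quadratic in n. *)
Lemma dependence_modulo (K : fieldType) (f : {mpoly K[3]}) (I : finType)
    (E : I -> {mpoly K[3]}) n :
  f != 0 -> (forall i, msize (E i) <= n.+1)%N ->
  ((msize f).-1 * n.+1 ^ 2 < #|I|)%N ->
  exists (u : I -> K) (q : {mpoly K[3]}), (exists i, u i != 0) /\ \sum_i u i *: E i = q * f.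
Proof.
move=> f0 En cI; set d := (msize f).-1 in cI.
have fd : msize f = d.+1 by rewrite prednK // lt0n msize_poly_eq0.
pose B : finType := 'X_{1..3 < n.+1 - d}.
pose V (x : I + B) : {mpoly K[3]} := match x with inl i => E i | inr m => 'X_[val m] * f end.
have Vn x : (msize (V x) <= n.+1)%N.
  case: x => [i|m] //=; apply: leq_trans (msizeM_leq _ _) _.
  by rewrite msizeX fd; have := bmdeg m; rewrite /=; lia.
have [|u [x0 ux0] hu] := @linear_dependence K _ _
    (fun (x : (I + B)%type) (m : 'X_{1..3 < n.+1}) => (V x)@_m).
  rewrite card_sum; apply: leq_ltn_trans (card_monomials_shell n d) _.
  by rewrite addnC ltn_add2r.
have rel : \sum_x u x *: V x = 0.
  apply/mpolyP => m; rewrite mcoeff0 raddf_sum /=.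
  case: (ltnP (mdeg m) n.+1) => hm.
    rewrite -[RHS](hu (BMultinom hm)); apply: eq_bigr => x _; by rewrite mcoeffZ.
  rewrite big1 // => x _; rewrite mcoeffZ memN_msupp_eq0 ?mulr0 //.
  by apply: msize_mdeg_ge; apply: leq_trans hm.
rewrite big_sumType /= in rel.
pose q := - \sum_m u (inr m) *: 'X_[val (m : B)].
exists (fun i => u (inl i)), q; split; last first.
  rewrite mulNr mulr_suml; apply/eqP; rewrite -addr_eq0; apply/eqP; rewrite -[RHS]rel.
  by congr (_ + _); apply: eq_bigr => m _; rewrite scalerAl.
(* If all the u (inl i) vanish, the relation is a nonzero multiple of f. *)
apply: contrapT => un; have uI i : u (inl i) = 0.
  by apply: contrapT => /eqP ui; apply: un; exists i.
move: rel; rewrite big1 ?add0r; last by move=> i _; rewrite uI scale0r.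
have -> : \sum_m u (inr m) *: ('X_[val (m : B)] * f) = - q * f.
  by rewrite opprK mulr_suml; apply: eq_bigr => m _; rewrite scalerAl.
move/eqP; rewrite mulf_eq0 (negPf f0) orbF => /eqP q0.
case: x0 ux0 => [i|m]; first by rewrite uI eqxx.
move/eqP; apply; move/mpolyP/(_ (val m)): q0; rewrite opprK mcoeff0 raddf_sum /=.
rewrite (bigD1 m) //= mcoeffZ mcoeffX eqxx mulr1 big1 ?addr0 // => m' mm'.
rewrite mcoeffZ mcoeffX; case: eqP => [e|]; last by rewrite mulr0.
by move/negP: mm'; case; apply/eqP/val_inj.
Qed.

Lemma msize_exp_leq n (K : idomainType) (p : {mpoly K[n]}) e k :
  (msize p <= e.+1)%N -> (msize (p ^+ k) <= (e * k).+1)%N.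
Proof.
move=> pe; elim: k => [|k IH]; first by rewrite expr0 msize1.
rewrite exprS; apply: leq_trans (msizeM_leq _ _) _; rewrite mulnS; lia.
Qed.

Lemma clear_denominators (F : fieldType) (l a1 a2 a3 b1 b2 b3 b4 : F) :
  b1 != 0 -> b2 != 0 -> b3 != 0 ->
  l * (a1 / b1) * (a2 / b2) * (a3 / b3) * (b1 * b2 * b3 * b4) = l * (a1 * a2 * a3 * b4).
Proof. by move=> *; field; apply/and3P; split. Qed.

Section UpperBound.
Variables (K : fieldType) (f : {mpoly K[3]}) (D : idomainType).
Variable pi : {rmorphism {mpoly K[3]} -> D}.
Hypotheses (f0 : f != 0) (piP : is_quotient_by f pi).
Local Notation "x %:F" := (@FracField.tofrac D x).

Lemma fraction_common (x1 x2 x3 : {fraction D}) : exists a1 a2 a3 b : D,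
  [/\ b != 0, x1 = a1%:F / b%:F, x2 = a2%:F / b%:F & x3 = a3%:F / b%:F].
Proof.
have [a [r [r0 ->]]] := fraction_repr x1.
have [b [s [s0 ->]]] := fraction_repr x2.
have [c [t [t0 ->]]] := fraction_repr x3.
exists (a * (s * t)), (b * (r * t)), (c * (r * s)), (r * s * t).
split; first by rewrite !mulf_neq0.
all: by apply/eqP; rewrite fraction_eq ?mulf_neq0 //; apply/eqP; ring.
Qed.

(** The monomials of exponents below N in three elements of degree at most e
    are N ^ 3 elements of the part of D of degree O(N), a space whose dimension
    is quadratic in N. *)
Lemma fraction_dependence (x1 x2 x3 : {fraction D}) :
  exists N (c : 'I_N -> 'I_N -> 'I_N -> K), (exists i j k, c i j k != 0) /\
    \sum_i \sum_j \sum_k (pi (c i j k)%:MP)%:F * x1 ^+ i * x2 ^+ j * x3 ^+ k = 0.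
Proof.
have [a1 [a2 [a3 [b [b0 -> -> ->]]]]] := fraction_common x1 x2 x3.
case: (piP) => pis pik.
have [A1 hA1] := pis a1; have [A2 hA2] := pis a2; have [A3 hA3] := pis a3.
have [B hB] := pis b.
pose e := (msize A1 + msize A2 + msize A3 + msize B)%N.
have eb : [/\ (msize A1 <= e)%N, (msize A2 <= e)%N, (msize A3 <= e)%N & (msize B <= e)%N].
  by rewrite /e; split; lia.
clearbody e; pose d := (msize f).-1.
(* This choice of N gives d (3 N e + 1)^2 <= d N^2 (3 e + 1)^2 < N^3. *)
have [N NE] : exists N, N = (d * (3 * e).+1 ^ 2).+1 by eexists.
(* The numerators of the monomials over the common denominator b^(3 N). *)
pose E (x : 'I_N * 'I_N * 'I_N) :=
  A1 ^+ x.1.1 * A2 ^+ x.1.2 * A3 ^+ x.2 * B ^+ (3 * N - x.1.1 - x.1.2 - x.2).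
have En x : (msize (E x) <= (e * (3 * N)).+1)%N.
  case: x => [[i j] k]; rewrite /E /=.
  have hi := ltn_ord i; have hj := ltn_ord j; have hk := ltn_ord k.
  have -> : (e * (3 * N) = e * i + e * j + e * k + e * (3 * N - i - j - k))%N.
    by rewrite -!mulnDr; congr (_ * _)%N; lia.
  have m1 : (msize (A1 ^+ i) <= (e * i).+1)%N by apply: msize_exp_leq; case: eb => *; apply: leqW.
  have m2 : (msize (A2 ^+ j) <= (e * j).+1)%N by apply: msize_exp_leq; case: eb => *; apply: leqW.
  have m3 : (msize (A3 ^+ k) <= (e * k).+1)%N by apply: msize_exp_leq; case: eb => *; apply: leqW.
  have m4 : (msize (B ^+ (3 * N - i - j - k)) <= (e * (3 * N - i - j - k)).+1)%N.
    by apply: msize_exp_leq; case: eb => *; apply: leqW.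
  apply: leq_trans (msizeM_leq _ _) _.
  apply: (@leq_trans ((e * i + e * j + e * k).+1 + (e * (3 * N - i - j - k)).+1).-1); last by lia.
  rewrite -!subn1 leq_sub2r // leq_add //.
  apply: leq_trans (msizeM_leq _ _) _; apply: (@leq_trans ((e * i + e * j).+1 + (e * k).+1).-1); last by lia.
  rewrite -!subn1 leq_sub2r // leq_add //.
  apply: leq_trans (msizeM_leq _ _) _; apply: (@leq_trans ((e * i).+1 + (e * j).+1).-1); last by lia.
  by rewrite -!subn1 leq_sub2r // leq_add.
have cN : ((msize f).-1 * (e * (3 * N)).+1 ^ 2 < #|{: 'I_N * 'I_N * 'I_N}|)%N.
  rewrite !card_prod card_ord -/d.
  have h : ((e * (3 * N)).+1 <= N * (3 * e).+1)%N.
    by rewrite mulnS; nia.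
  apply: (@leq_ltn_trans (d * (N * (3 * e).+1) ^ 2)%N).
    by rewrite leq_mul2l leq_exp2r // h orbT.
  rewrite expnMn [(N ^ 2 * _)%N]mulnC mulnA -[(N ^ 2)%N]mulnn mulnA !ltn_mul2r.
  by rewrite NE ltnSn.
have [u [q [[[[i j] k] ui] rel]]] := dependence_modulo f0 En cN.
exists N, (fun i j k => u (i, j, k)); split; first by exists i, j, k.
apply: (mulIf (expf_neq0 (3 * N) (_ : b%:F != 0))); first by rewrite tofrac_eq0.
have rel0 : \sum_x (pi (u x)%:MP)%:F * (pi (E x))%:F = 0.
  have e0 : (pi (\sum_x u x *: E x))%:F = 0.
    by rewrite (_ : pi _ = 0) ?rmorph0 // pik rel; exists q.
  apply: etrans e0; rewrite !rmorph_sum /=; apply: eq_bigr => x _.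
  by rewrite -mul_mpolyC !rmorphM.
rewrite mul0r; apply: etrans rel0; rewrite pair_bigA /= pair_bigA /= mulr_suml.
apply: eq_bigr => -[[i' j'] k'] _ /=; rewrite /E /= !rmorphM !rmorphXn /= hA1 hA2 hA3 hB.
have hi := ltn_ord i'; have hj := ltn_ord j'; have hk := ltn_ord k'.
have nzb : b%:F != 0 by rewrite tofrac_eq0.
rewrite !expr_div_n.
have -> : b%:F ^+ (3 * N) = b%:F ^+ i' * b%:F ^+ j' * b%:F ^+ k' * b%:F ^+ (3 * N - i' - j' - k').
  by rewrite -!exprD; congr (_ ^+ _); lia.
have nz1 := expf_neq0 i' nzb; have nz2 := expf_neq0 j' nzb; have nz3 := expf_neq0 k' nzb.
exact: clear_denominators.
Qed.

(** A nonzero constant is the reciprocal of its inverse. *)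
Lemma recip_const_subproof (a : K) : (pi a%:MP)%:F \in @recip_pred D.
Proof.
have [->|a0] := eqVneq a 0; first by rewrite !rmorph0 rpred0.
have ia : (pi a^-1%:MP)%:F * (pi a%:MP)%:F = 1 by rewrite -!rmorphM /= mulVf ?rmorph1.
have i0 : pi a^-1%:MP != 0.
  by apply: contra_eq_neq ia => ->; rewrite rmorph0 mul0r eq_sym oner_eq0.
have -> : (pi a%:MP)%:F = ((pi a^-1%:MP)%:F)^-1.
  by apply: (mulfI (_ : (pi a^-1%:MP)%:F != 0)); rewrite ?mulfV ?tofrac_eq0.
exact: recip_inv.
Qed.

Definition recip_const (a : K) : recip_compl D := RecipCompl (recip_const_subproof a).

(** Elements separating the successive primes of a longer chain would satisfy the
    relation of [fraction_dependence], whose nonzero coefficients are units of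
    the reciprocal complement; [prime_chain_independent] excludes this. *)
Theorem recip_compl_prime_chain_le2 m (P : nat -> {pred recip_compl D}) :
  prime_chain m P -> (m <= 2)%N.
Proof.
move=> Pc; rewrite leqNgt; apply/negP => m3.
have {m3} Pc : prime_chain 3 P.
  case: Pc => Pp Pinc; split=> i hi; [apply: Pp | apply: Pinc]; lia.
have step i : (i < 3)%N -> exists2 x, x \in P i.+1 & x \notin P i.
  case: Pc => _ Pinc /Pinc [_ ns]; apply: contrapT => h; apply: ns => x xP.
  by apply: contrapT => /negP nx; apply: h; exists x.
have [x1 x11 x10] := step 0%N isT.
have [x2 x22 x21] := step 1%N isT.
have [x3 x33 x32] := step 2%N isT.
have [N [c [[i [j [k cn]]] rel]]] := fraction_dependence (val x1) (val x2) (val x3).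
have := @prime_chain_independent _ P x1 x2 x3 N
  (fun i j k => recip_const (c i j k)) Pc x10 x11 x21 x22 x32 x33.
have constM a b : recip_const a * recip_const b = recip_const (a * b).
  by apply: val_inj; rewrite /= !rmorphM.
have const0 a : recip_const a = 0 -> a = 0.
  move=> h; apply/eqP; apply: contraT => a0.
  have : recip_const a^-1 * recip_const a = 1.
    by rewrite constM mulVf //; apply: val_inj; rewrite /= !rmorph1.
  by rewrite h mulr0 => /eqP; rewrite eq_sym oner_eq0.
move=> H; move: cn; rewrite (const0 _ (H _ _ i j k)) ?eqxx //.
  move=> i' j' k' nz; exists (recip_const (c i' j' k')^-1).
  rewrite constM mulVf; first by apply: val_inj; rewrite /= !rmorph1.
  by apply: contra_neq nz => ->; apply: val_inj; rewrite /= !rmorph0.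
apply: val_inj; rewrite rmorph0; apply: etrans rel.
rewrite rmorph_sum; apply: eq_bigr => i' _; rewrite rmorph_sum; apply: eq_bigr => j' _.
by rewrite rmorph_sum; apply: eq_bigr => k' _; rewrite !rmorphM !rmorphXn.
Qed.

End UpperBound.

(** * Valuations from leading forms *)

Lemma coefM_top (R : nzRingType) (p q : {poly R}) n m :
  (size p <= n.+1)%N -> (size q <= m.+1)%N -> (p * q)`_(n + m) = p`_n * q`_m.
Proof.
move=> pn qm; have nl : (n < (n + m).+1)%N by rewrite ltnS leq_addr.
rewrite coefM (bigD1 (Ordinal nl)) //= addKn big1 ?addr0 // => i ni.
case: (ltngtP i n) => h.
- by rewrite [q`_ _]nth_default ?mulr0 //; apply: leq_trans qm _; lia.
- by rewrite nth_default ?mul0r //; apply: leq_trans pn _.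
- by case/eqP: ni; apply: val_inj.
Qed.

Lemma zero_prime (D : idomainType) : prime_ideal (fun q : recip_compl D => q == 0).
Proof.
split; first split.
- by rewrite unfold_in eqxx.
- by rewrite unfold_in oner_eq0.
- by move=> a u v; rewrite !unfold_in => /eqP-> /eqP->; rewrite mulr0 addr0.
move=> u v; rewrite !unfold_in => /eqP/(congr1 val)/eqP.
rewrite rmorphM rmorph0 mulf_eq0 => /orP[] /eqP e; apply/orP; [left|right];
  by apply/eqP/val_inj; rewrite rmorph0.
Qed.

(** T expands the elements of R in powers of a degree variable, and ev takes
    values of the coefficients.  The leading coefficient of f has value 0, while
    each nonzero class modulo f has a representative whose leading coefficient
    has a nonzero value.  The degree of such a representative and this value
    then depend only on the class, as if they had been read off an expansion of
    the class in Laurent series. *)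
Section LeadingForms.
Variables (R : comNzRingType) (B A D : idomainType) (f : R) (N : nat).
Variables (T : {rmorphism R -> {poly B}}) (ev : {rmorphism B -> A}) (pi : {rmorphism R -> D}).
Hypotheses (piP : is_quotient_by f pi) (Tf_size : size (T f) = N.+1).
Hypothesis Tf_top : ev (T f)`_N = 0.
Hypothesis nondegenerate : forall x, x != 0 ->
  exists h, [/\ pi h = x, T h != 0 & ev (lead_coef (T h)) != 0].

(** As a may vanish, this only bounds the order of x by n, which makes the
    relation additive; the order is n exactly when a is nonzero. *)
Definition leading (x : D) (n : nat) (a : A) : Prop :=
  exists h, [/\ pi h = x, (size (T h) <= n.+1)%N & ev (T h)`_n = a].

Lemma leading_mul x y n m a c :
  leading x n a -> leading y m c -> leading (x * y) (n + m) (a * c).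
Proof.
case=> [h [<- hn <-]] [k [<- km <-]]; exists (h * k); split; first by rewrite rmorphM.
  rewrite rmorphM; apply: leq_trans (size_polyMleq _ _) _ => /=.
  by rewrite -subn1 leq_subLR add1n -addnS -addSn leq_add.
by rewrite rmorphM coefM_top // rmorphM.
Qed.

Lemma leading_add x y n a c : leading x n a -> leading y n c -> leading (x + y) n (a + c).
Proof.
case=> [h [<- hn <-]] [k [<- kn <-]]; exists (h + k); split; first by rewrite rmorphD.
  by rewrite rmorphD; apply: leq_trans (size_polyD _ _) _; rewrite geq_max hn.
by rewrite rmorphD coefD rmorphD.
Qed.

Lemma leading_opp x n a : leading x n a -> leading (- x) n (- a).
Proof.
case=> [h [<- hn <-]]; exists (- h); split; first by rewrite rmorphN.
  by rewrite rmorphN size_polyN.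
by rewrite rmorphN coefN rmorphN.
Qed.

Lemma leading_lift x n m a : (n < m)%N -> leading x n a -> leading x m 0.
Proof.
move=> nm [h [<- hn _]]; exists h; split=> //; first exact: leq_trans hn (leqW nm).
by rewrite nth_default ?rmorph0 // (leq_trans hn).
Qed.

(** The leading coefficient of a multiple of f is a multiple of that of f, on
    which ev vanishes. *)
Lemma leading_zero n a : leading 0 n a -> a = 0.
Proof.
case=> h [/(proj2 piP) [q ->] hn <-]; rewrite rmorphM in hn *.
have [->|q0] := eqVneq (T q) 0; first by rewrite mul0r coef0 rmorph0.
have f0 : T f != 0 by rewrite -size_poly_eq0 Tf_size.
have qn : (size (T q) + N <= n.+1)%N.
  by move: hn; rewrite size_mul // Tf_size addnS.
have q1 : (0 < size (T q))%N by rewrite lt0n size_poly_eq0.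
have nN : (N <= n)%N by lia.
(* T q has degree at most n - N, so the value is that of a product with the
   leading coefficient of T f. *)
rewrite -(subnK nN) coefM_top ?Tf_size //; last first.
  by rewrite -(leq_add2r N) addSn subnK.
by rewrite rmorphM Tf_top mulr0.
Qed.

Lemma leading_exists x : x != 0 -> exists n a, leading x n a /\ a != 0.
Proof.
case/nondegenerate => h [hx t0 ta].
exists (size (T h)).-1, (ev (lead_coef (T h))); split=> //.
by exists h; rewrite prednK // lt0n size_poly_eq0.
Qed.

(** Otherwise the difference of the two relations would contradict
    [leading_zero]. *)
Lemma leading_leq x n m a c :
  leading x n a -> leading x m c -> c != 0 -> (m <= n)%N.
Proof.
move=> xn xm c0; rewrite leqNgt; apply/negP => nm.
have := leading_add xm (leading_opp (leading_lift nm xn)).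
by rewrite subrr => /leading_zero/eqP; rewrite subr0 (negPf c0).
Qed.

Lemma leading_unique x n a c : leading x n a -> leading x n c -> a = c.
Proof.
move=> xa xc; have := leading_add xa (leading_opp xc).
by rewrite subrr => /leading_zero/eqP; rewrite subr_eq0 => /eqP.
Qed.

Lemma leading_neq0 x n a : leading x n a -> a != 0 -> x != 0.
Proof. by move=> xa; apply: contra_neq => x0; apply: (@leading_zero n); rewrite -x0. Qed.

Section Comparison.
Variables (w : D -> nat) (l : D -> A).
Hypothesis wlP : forall x, x != 0 -> leading x (w x) (l x) /\ l x != 0.

Lemma lead_eq x n a : leading x n a -> a != 0 -> w x = n /\ l x = a.
Proof.
move=> xa a0; have [xl l0] := wlP (leading_neq0 xa a0).
have e : w x = n by apply/eqP; rewrite eqn_leq (leading_leq xa xl) // (leading_leq xl xa).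
by split=> //; apply: leading_unique xl _; rewrite e.
Qed.

Lemma lead_lt x n : x != 0 -> leading x n 0 -> (w x < n)%N.
Proof.
move=> x0 xn; have [xl l0] := wlP x0.
rewrite ltn_neqAle (leading_leq xn xl) // andbT; apply: contraNneq l0 => e.
by rewrite (leading_unique xl (c := 0)) // e.
Qed.

(** Lexicographic comparison of the order with a secondary size s of the
    leading value; for constant s only the order is compared. *)
Definition lex_le (s : A -> nat) (x y : D) : bool :=
  (x == 0) || (y != 0) && ((w x < w y)%N || (w x == w y) && (s (l x) <= s (l y))%N).

(** The conditions are those of a degree shifted by s 1; both the size of a
    polynomial and a constant satisfy them. *)
Lemma lex_le_comparison (s : A -> nat) :
  (forall a c : A, a != 0 -> c != 0 -> (s (a * c)%R + s 1%R = s a + s c)%N) ->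
  (forall a c : A, (s (a + c)%R <= maxn (s a) (s c))%N) ->
  (forall a : A, a != 0 -> (s 1%R <= s a)%N) ->
  degree_comparison (lex_le s).
Proof.
move=> sM sD s1; split.
- move=> x y; rewrite /lex_le; case: eqP => //= _; case: eqP => //= _.
  by lia.
- move=> y x z; rewrite /lex_le; case: (x =P 0) => //= _.
  by case: (y =P 0) => //= _; case: (z =P 0) => //= _; lia.
- move=> x y z; have [->|x0] := eqVneq x 0; first by rewrite add0r.
  have [->|y0] := eqVneq y 0; first by rewrite addr0.
  rewrite /lex_le (negPf x0) (negPf y0) /=; case: (eqVneq (x + y) 0) => //= xy0.
  case: (eqVneq z 0) => //= z0.
  have [xl lx0] := wlP x0; have [yl ly0] := wlP y0.
  case: (ltngtP (w x) (w y)) => h.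
  (* The summand of larger order dominates. *)
  + have := leading_add (leading_lift h xl) yl; rewrite add0r => /lead_eq[] // -> ->; lia.
  + have := leading_add xl (leading_lift h yl); rewrite addr0 => /lead_eq[] // -> ->; lia.
  (* For equal orders the leading values may cancel, and the order drops. *)
  rewrite -h in yl *; have := leading_add xl yl.
  have [->|c0] := eqVneq (l x + l y) 0; first by move/(lead_lt xy0); lia.
  by case/lead_eq => // -> ->; have := sD (l x) (l y); lia.
- move=> x y z z0; have [->|x0] := eqVneq x 0; first by rewrite mul0r /lex_le eqxx.
  have [->|y0] := eqVneq y 0.
    by rewrite mul0r /lex_le eqxx /= !orbF mulf_eq0 (negPf z0) orbF.
  have [xl lx0] := wlP x0; have [yl ly0] := wlP y0; have [zl lz0] := wlP z0.
  have [wx lx] := lead_eq (leading_mul xl zl) (mulf_neq0 lx0 lz0).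
  have [wy ly] := lead_eq (leading_mul yl zl) (mulf_neq0 ly0 lz0).
  rewrite /lex_le !mulf_eq0 (negPf x0) (negPf y0) (negPf z0) /= wx wy lx ly.
  have := sM _ _ lx0 lz0; have := sM _ _ ly0 lz0.
  by rewrite ltn_add2r eqn_add2r; lia.
- move=> y y0; have l1 : leading 1 0 1.
    by exists 1; rewrite !rmorph1 size_poly1 coef1 rmorph1.
  have [w1 ll1] := lead_eq l1 (oner_neq0 _).
  have [yl ly0] := wlP y0.
  by rewrite /lex_le y0 oner_eq0 w1 ll1 /=; have := s1 _ ly0; lia.
- by move=> x; rewrite /lex_le eqxx orbF.
Qed.
End Comparison.

End LeadingForms.

(** The reciprocal of z lies in the prime of the order, that of c only in the
    prime of the lexicographic valuation, whose secondary size is the degree of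
    the leading value. *)
Theorem leading_prime_chain (K : fieldType) (R : comNzRingType) (B D : idomainType)
    (f : R) (N : nat) (T : {rmorphism R -> {poly B}}) (ev : {rmorphism B -> {poly K}})
    (pi : {rmorphism R -> D}) (z c : D) (n : nat) (az ac : {poly K}) :
  is_quotient_by f pi -> size (T f) = N.+1 -> ev (T f)`_N = 0 ->
  (forall x, x != 0 -> exists h, [/\ pi h = x, T h != 0 & ev (lead_coef (T h)) != 0]) ->
  leading T ev pi z n az -> (0 < n)%N -> az != 0 ->
  leading T ev pi c 0 ac -> (1 < size ac)%N ->
  exists P : nat -> {pred recip_compl D}, prime_chain 2 P.
Proof.
move=> piP Tf_size Tf_top nondeg leadz n0 az0 leadc ac1.
have /choice[na naP] (x : D) : exists na : nat * {poly K},
    x != 0 -> leading T ev pi x na.1 na.2 /\ na.2 != 0.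
  have [->|/(leading_exists nondeg)[m [a xa]]] := eqVneq x 0; last by exists (m, a).
  by exists (0%N, 0).
pose w x := (na x).1; pose l x := (na x).2.
pose le1 := lex_le w l (fun _ => 0%N); pose le2 := lex_le w l (fun a => size a).
have le1P : degree_comparison le1 by apply: (lex_le_comparison piP Tf_size Tf_top naP).
have le2P : degree_comparison le2.
  apply: (lex_le_comparison piP Tf_size Tf_top naP) => [a e a0 e0|a e|a a0].
  - rewrite size_mul // size_poly1 addn1 prednK // addn_gt0 lt0n size_poly_eq0 a0 //.
  - exact: size_polyD.
  by rewrite size_poly1 lt0n size_poly_eq0.
have small21 q : small le1 q -> small le2 q.
  have [x [y [y0 ->]]] := fraction_repr q; rewrite !smallE //.
  apply: contra; rewrite /le1 /le2 /lex_le; case: (y =P 0) => //= _; case: (x =P 0) => //= _.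
  by lia.
have lead1 : leading T ev pi 1 0 1 by exists 1; rewrite !rmorph1 size_poly1 coef1 rmorph1.
have ac0 : ac != 0 by rewrite -size_poly_gt0 (ltn_trans _ ac1).
have z0 : z != 0 by apply: (leading_neq0 piP Tf_size Tf_top leadz az0).
have c0 : c != 0 by apply: (leading_neq0 piP Tf_size Tf_top leadc ac0).
have [w1 l1] := lead_eq piP Tf_size Tf_top naP lead1 (oner_neq0 _).
have [wz _] := lead_eq piP Tf_size Tf_top naP leadz az0.
have [wc lc] := lead_eq piP Tf_size Tf_top naP leadc ac0.
pose Rz := RecipCompl (recip_inv z0); pose Rc := RecipCompl (recip_inv c0).
have inv_small le (leP : degree_comparison le) x (x0 : x != 0) :
    (RecipCompl (recip_inv x0) \in centre le) = ~~ le x 1.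
  by rewrite in_centre /= -div1r -tofrac1 smallE.
exists (fun i => if i is i.+1 then if i is _.+1 then centre le2 else centre le1
                 else fun q => q == 0); split.
  case=> [|[|[|//]]] _; [exact: zero_prime|exact: centre_prime|exact: centre_prime].
case=> [|[|//]] _; split.
- by move=> q; rewrite unfold_in => /eqP->; case: (centre_prime le1P) => -[].
- move/(_ Rz); rewrite inv_small // /le1 /lex_le (negPf z0) oner_eq0 /= /w w1 wz ltn0 /=.
  rewrite (negPf (lt0n_neq0 n0)) => /(_ isT); rewrite unfold_in => /eqP/(congr1 val)/eqP /=.
  by rewrite invr_eq0 tofrac_eq0 (negPf z0).
- by move=> q; rewrite !in_centre => /small21.
move/(_ Rc); rewrite !inv_small // /le1 /le2 /lex_le (negPf c0) oner_eq0 /= /w w1 wc eqxx /=.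
by rewrite /l lc l1 size_poly1 leqNgt ac1 => /(_ isT).
Qed.

(** * The branch at infinity of the curve over K(c) *)

Section Weights.
Variables (A : idomainType) (d : nat).
Hypothesis d0 : (0 < d)%N.
Implicit Types h : {poly {poly A}}.

(** The pole order of X^i Z^j along the branch. *)
Definition weight (i j : nat) : nat := (i * d.-1 + j * d)%N.

(** The weight of X^i Z^j is congruent to - i modulo d. *)
Lemma weight_inj i j i' j' :
  (i < d)%N -> (i' < d)%N -> weight i j = weight i' j' -> i = i' /\ j = j'.
Proof.
move=> hi hi' e.
have {}e : ((i + j) * d + i' = (i' + j') * d + i)%N.
  move: e; rewrite /weight !mulnDl; have -> : d = d.-1.+1 by rewrite prednK.
  by rewrite !mulnS /=; lia.
have ii : i = i'.
  by move/(congr1 (modn^~ d)): (e); rewrite !modnMDl !modn_small // => ->.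
split=> //; move: e; rewrite ii => /eqP; rewrite eqn_add2r eqn_pmul2r // => /eqP.
by move/addnI.
Qed.

Definition subst_inner : {poly A} -> {poly {poly A}} :=
  horner_eval ('X%:P * 'X^d) \o map_poly (polyC \o polyC).
HB.instance Definition _ := GRing.RMorphism.on subst_inner.

(** With U and T the inner and the outer variable of the target, X is sent to
    U T^(d-1) and Z to U T^d.  The exponent of T records the weight, and the
    first-order parametrisation of the branch corresponds to U = b. *)
Definition subst_branch : {poly {poly A}} -> {poly {poly A}} :=
  horner_eval ('X%:P * 'X^(d.-1)) \o map_poly subst_inner.
HB.instance Definition _ := GRing.RMorphism.on subst_branch.

Lemma subst_innerC (a : A) : subst_inner a%:P = a%:P%:P.
Proof. by rewrite /subst_inner /= /horner_eval map_polyC hornerC. Qed.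

Lemma subst_innerX : subst_inner 'X = 'X%:P * 'X^d.
Proof. by rewrite /subst_inner /= /horner_eval map_polyX hornerX. Qed.

Lemma subst_branchC (q : {poly A}) : subst_branch q%:P = subst_inner q.
Proof. by rewrite /subst_branch /= /horner_eval map_polyC hornerC. Qed.

Lemma subst_branchX : subst_branch 'X = 'X%:P * 'X^(d.-1).
Proof. by rewrite /subst_branch /= /horner_eval map_polyX hornerX. Qed.

Lemma subst_branch_coef h n : (subst_branch h)`_n =
  \sum_(i < size h) \sum_(j < size h`_i) (if weight i j == n then h`_i`_j *: 'X^(i + j) else 0).
Proof.
rewrite -[h in LHS]coefK poly_def rmorph_sum coef_sum; apply: eq_bigr => i _.
rewrite -mul_polyC rmorphM rmorphXn /= subst_branchC subst_branchX.
rewrite -[h`_i in LHS]coefK poly_def rmorph_sum mulr_suml coef_sum; apply: eq_bigr => j _.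
rewrite -mul_polyC rmorphM rmorphXn /= subst_innerC subst_innerX.
have -> : (h`_i`_j)%:P%:P * ('X%:P * 'X^d) ^+ j * ('X%:P * 'X^(d.-1)) ^+ i
    = (h`_i`_j *: 'X^(i + j))%:P * 'X^(weight i j) :> {poly {poly A}}.
  by rewrite -mul_polyC polyCM polyC_exp !exprMn -!exprM /weight !exprD
    [(i * _)%N]mulnC [(j * _)%N]mulnC; ring.
by rewrite coefCM coefXn eq_sym; case: eqP; rewrite ?mulr1 ?mulr0.
Qed.

Lemma size_subst_branch h n :
  (forall i j, h`_i`_j != 0 -> (weight i j < n)%N) -> (size (subst_branch h) <= n)%N.
Proof.
move=> hn; apply/leq_sizeP => m nm; rewrite subst_branch_coef big1 // => i _; rewrite big1 // => j _.
case: eqP => // e; have [->|/hn] := eqVneq (h`_i`_j) 0; first by rewrite scale0r.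
by rewrite e ltnNge nm.
Qed.

Lemma subst_branch_coef_reduced h (i : 'I_(size h)) (j : 'I_(size h`_i)) :
  (size h <= d)%N -> (subst_branch h)`_(weight i j) = h`_i`_j *: 'X^(i + j).
Proof.
move=> hd; rewrite subst_branch_coef (bigD1 i) //= (bigD1 j) //= eqxx.
rewrite big1 ?addr0 => [|j' jj].
  rewrite big1 ?addr0 // => i' ii; rewrite big1 // => j' _.
  case: eqP => // /weight_inj[]; rewrite ?(leq_trans _ hd) // => e.
  by case/eqP: ii; apply: val_inj.
case: eqP => // /weight_inj[]; rewrite ?(leq_trans _ hd) // => _ e.
by case/eqP: jj; apply: val_inj.
Qed.

(** In a remainder modulo a polynomial of degree d in X, distinct monomials
    have distinct weights, so the leading form is a single monomial and no
    cancellation can occur when it is evaluated. *)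
Lemma subst_branch_lead_reduced h (b : A) : h != 0 -> (size h <= d)%N -> b != 0 ->
  subst_branch h != 0 /\ (lead_coef (subst_branch h)).[b] != 0.
Proof.
move=> h0 hd b0.
have th0 : subst_branch h != 0.
  have hi : ((size h).-1 < size h)%N by rewrite prednK ?lt0n ?size_poly_eq0.
  have l0 : h`_(Ordinal hi) != 0 by rewrite -[h`_ _]/(lead_coef h) lead_coef_eq0.
  have hj : ((size (h`_(Ordinal hi))%R).-1 < size (h`_(Ordinal hi))%R)%N.
    by rewrite prednK ?lt0n ?size_poly_eq0.
  apply: contra_neq (_ : h`_(Ordinal hi)`_(Ordinal hj) != 0) => [t0|].
    have := @subst_branch_coef_reduced h (Ordinal hi) (Ordinal hj) hd.
    rewrite t0 coef0 => /esym/eqP.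
    by rewrite -mul_polyC mulf_eq0 polyC_eq0 -size_poly_eq0 size_polyXn orbF => /eqP.
  by rewrite -[_`_(Ordinal hj)]/(lead_coef _) lead_coef_eq0.
split=> //; move: (th0); rewrite -lead_coef_eq0 /lead_coef; set n := _.-1.
case: (pselect (exists (i : 'I_(size h)) (j : 'I_(size h`_i)), weight i j = n)).
  case=> i [j <-]; rewrite subst_branch_coef_reduced // -mul_polyC hornerM hornerC hornerXn.
  rewrite !mulf_eq0 polyC_eq0 => /norP[c0 _].
  by rewrite (negPf c0) (negPf (expf_neq0 _ b0)).
move=> nex; rewrite subst_branch_coef big1 ?eqxx // => i _; rewrite big1 // => j _.
by case: eqP => // e; case: nex; exists i, j.
Qed.
End Weights.

(** By the hypotheses on the coefficients, the Newton polygon of f has at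
    infinity the single edge from X^d to Z^(d-1). *)
Section Branch.
Variables (K : fieldType) (d : nat) (f : {poly {poly {poly K}}}).
Hypotheses (d0 : (0 < d)%N) (f_monic : f \is monic) (f_size : size f = d.+1).
Hypothesis f_low : forall i j, (i < d)%N -> (d <= i + j)%N -> f`_i`_j = 0.
Let b : {poly K} := - f`_0`_(d.-1).
Hypothesis b0 : b != 0.
Let N := (d * d.-1)%N.

Lemma subst_branch_f_coef : (subst_branch d f)`_N = 'X^d - b *: 'X^(d.-1).
Proof.
have [r rE] : exists r, r = f - 'X^d + (b *: 'X^(d.-1))%:P by eexists.
have rN : (size (subst_branch d r) <= N)%N.
  apply: size_subst_branch => i j; rewrite rE !coefD coefN coefXn coefC.
  have [->|id] := eqVneq i d.
    have -> : f`_d = 1 by move/monicP: f_monic; rewrite /lead_coef f_size.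
    rewrite -[1 *- true]/(- 1) -coefD subrr coef0 add0r (negPf (lt0n_neq0 d0)).
    by rewrite coef0 eqxx.
  rewrite -[1 *- false]/(- 0) oppr0 coef0 addr0; have [di|di] := ltnP d i.
    rewrite (negPf (lt0n_neq0 (leq_ltn_trans (leq0n _) di))) coef0 addr0.
    by rewrite [f`_i]nth_default ?f_size // coef0 eqxx.
  have {id} id : (i < d)%N by rewrite ltn_neqAle id.
  have [dij|dij] := leqP d (i + j).
    rewrite f_low // add0r; case: (i =P 0%N) dij => [-> dj|]; last by rewrite coef0 eqxx.
    by rewrite coefZ coefXn; case: (j =P d.-1) => [|_]; [lia | rewrite mulr0 eqxx].
  case: (i =P 0%N) => [i0|i0].
    rewrite i0 coefZ coefXn; case: (j =P d.-1) => [->|jd _]; first by rewrite mulr1 subrr eqxx.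
    rewrite /weight /N mul0n add0n mulnC ltn_pmul2l //; lia.
  move=> _; rewrite /weight /N.
  have -> : d = d.-1.+1 by rewrite prednK.
  by rewrite /=; nia.
have fE : f = 'X^d + (r - (b *: 'X^(d.-1))%:P) by rewrite rE; ring.
rewrite [in LHS]fE.
rewrite !rmorphD rmorphN rmorphXn /= subst_branchX subst_branchC !coefD coefN.
rewrite [X in _ + (X - _)]nth_default // add0r; congr (_ - _).
  by rewrite exprMn -exprM -polyC_exp coefCM mulnC -/N coefXn eqxx mulr1.
rewrite -mul_polyC rmorphM rmorphXn /= subst_innerC subst_innerX.
by rewrite exprMn -exprM -polyC_exp mulrA -polyCM coefCM -/N coefXn eqxx mulr1 mul_polyC.
Qed.

Lemma subst_branch_f_size : size (subst_branch d f) = N.+1.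
Proof.
apply/eqP; rewrite eqn_leq; apply/andP; split; last first.
  rewrite ltnNge; apply/negP => /leq_sizeP/(_ N (leqnn _)).
  rewrite subst_branch_f_coef => /eqP; rewrite subr_eq0 => /eqP/(congr1 (fun q : {poly _} => size q)).
  rewrite size_polyXn size_scale // size_polyXn prednK // => /eqP.
  by rewrite eqn_leq ltnn.
apply: size_subst_branch => i j; have [dj|dj] := ltnP d i.
  by rewrite [f`_i]nth_default ?f_size // coef0 eqxx.
have [ei|id] := eqVneq i d.
  rewrite ei; have -> : f`_d = 1 by move/monicP: f_monic; rewrite /lead_coef f_size.
  by rewrite coef1; case: j => [|j]; rewrite ?eqxx // /weight mul0n addn0 /N ltnS.
have {dj} id' : (i < d)%N by rewrite ltn_neqAle id.
have [dij|dij _] := leqP d (i + j); first by rewrite f_low // eqxx.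
rewrite /weight /N ltnS; have -> : d = d.-1.+1 by rewrite prednK.
by rewrite /=; nia.
Qed.

(** The remainders modulo f, as a polynomial in X, are the representatives with
    nonvanishing leading value; 1/Z and 1/c separate the primes. *)
Theorem branch_prime_chain (D : idomainType) (pi : {rmorphism {poly {poly {poly K}}} -> D}) :
  is_quotient_by f pi -> exists P : nat -> {pred recip_compl D}, prime_chain 2 P.
Proof.
move=> piP; pose T : {rmorphism {poly {poly {poly K}}} -> {poly {poly {poly K}}}} := subst_branch d.
pose ev : {rmorphism {poly {poly K}} -> {poly K}} := horner_eval b.
have leadz : leading T ev pi (pi 'X%:P) d b.
  have tX : subst_branch d ('X%:P : {poly {poly {poly K}}}) = 'X%:P * 'X^d.
    by rewrite subst_branchC subst_innerX.
  exists 'X%:P; rewrite /T /= tX; split=> //.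
    by rewrite size_Cmul ?polyX_eq0 // size_polyXn.
  by rewrite coefCM coefXn eqxx mulr1 /ev /= /horner_eval hornerX.
have leadc : leading T ev pi (pi 'X%:P%:P) 0 'X.
  have tX : subst_branch d ('X%:P%:P : {poly {poly {poly K}}}) = 'X%:P%:P.
    by rewrite subst_branchC subst_innerC.
  exists 'X%:P%:P; rewrite /T /= tX; split=> //; first exact: size_polyC_leq1.
  by rewrite coefC /ev /= /horner_eval hornerC.
apply: (leading_prime_chain piP (N := N) _ _ _ leadz d0 b0 leadc); rewrite ?size_polyX //.
- exact: subst_branch_f_size.
- rewrite /T /ev /= subst_branch_f_coef /horner_eval hornerD hornerN hornerZ !hornerXn -exprS prednK //.
  by rewrite subrr.
move=> x x0; have [h hx] := proj1 piP x.
pose r := Pdiv.Ring.rmodp h f.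
have rx : pi r = x.
  rewrite -hx [h in RHS](Pdiv.RingMonic.rdivp_eq f_monic) rmorphD rmorphM.
  by rewrite (_ : pi f = 0) ?mulr0 ?add0r //; apply/(proj2 piP); exists 1; rewrite mul1r.
have r0 : r != 0 by apply: contra_neq x0 => r0; rewrite -rx r0 rmorph0.
have rd : (size r <= d)%N.
  by rewrite -ltnS -f_size Pdiv.Ring.ltn_rmodpN0 // monic_neq0.
have [t0 tb] := subst_branch_lead_reduced d0 r0 rd b0.
by exists r.
Qed.

End Branch.

(** * Homogeneous polynomials *)

(** Among the products of monomials of the factors, the product of the two
    largest and that of the two smallest arise only once, so both survive. *)
Lemma dhomog_factor n (K : idomainType) (p q : {mpoly K[n]}) d :
  p * q \is d.-homog -> p * q != 0 -> p \is ((msize p).-1).-homog.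
Proof.
move=> /dhomogP pqd pq0; have [p0 q0] : p != 0 /\ q != 0.
  by apply/andP; rewrite -negb_or -mulf_eq0.
have top : (mdeg (mlead p) + mdeg (mlead q) = d)%N.
  by rewrite -mdegD -mleadM //; apply: pqd; exact: mlead_supp.
have bot : (mdeg (mlast p) + mdeg (mlast q) = d)%N.
  rewrite -mdegD; apply: pqd.
  rewrite mcoeff_msupp [p in p * q]mpolyE [q in _ * q]mpolyE mulr_suml raddf_sum /=.
  rewrite (bigD1_seq (mlast p)) ?mlast_supp ?msupp_uniq //= [X in _ + X]big1_seq ?addr0.
    rewrite mulr_sumr raddf_sum /= (bigD1_seq (mlast q)) ?mlast_supp ?msupp_uniq //=.
    rewrite [X in _ + X]big1_seq ?addr0.
      rewrite -scalerAl -scalerAr -mpolyXD !mcoeffZ mcoeffX eqxx mulr1.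
      by rewrite mulf_neq0 // -mcoeff_msupp mlast_supp.
    move=> m /andP[mq _]; rewrite -scalerAl -scalerAr -mpolyXD !mcoeffZ mcoeffX eqm_add2l.
    by rewrite (negPf mq) !mulr0.
  move=> m /andP[mp mps]; rewrite mulr_sumr raddf_sum /= big1_seq // => m' /= mqs.
  rewrite -scalerAl -scalerAr -mpolyXD !mcoeffZ mcoeffX.
  case: eqP => [e|]; last by rewrite !mulr0.
  have lt : ((mlast p + mlast q)%MM < (m + m')%MM)%O.
    apply: ltmc_le_add; last exact: mlast_lemc.
    by rewrite Order.POrderTheory.lt_neqAle eq_sym mp mlast_lemc.
  by move: lt; rewrite e Order.POrderTheory.ltxx.
have lep := lemc_mdeg (mlast_lemc (mlead_supp p0)).
have leq := lemc_mdeg (mlast_lemc (mlead_supp q0)).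
apply/dhomogP => m mp; rewrite -mlead_deg //=.
have := lemc_mdeg (mlast_lemc mp); have := lemc_mdeg (msupp_le_mlead mp); lia.
Qed.

Lemma mmap_homog_scale n (K L : fieldType) (iota : {rmorphism K -> L}) (h : {mpoly K[n]})
    k (v : 'I_n -> K) (c : L) :
  h \is k.-homog ->
  (map_mpoly iota h).@[fun i => c * iota (v i)] = c ^+ k * iota (h.@[v]).
Proof.
move=> /dhomogP hk; rewrite (mevalE v).
have -> : map_mpoly iota h = \sum_(m <- msupp h) iota h@_m *: 'X_[m].
  rewrite {1}(mpolyE h) (raddf_sum (map_mpoly iota)).
  by apply: eq_bigr => m _; rewrite /= map_mpolyZ map_mpolyX.
rewrite (raddf_sum (meval (fun i => c * iota (v i)))) (rmorph_sum iota) mulr_sumr.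
rewrite big_seq [RHS]big_seq; apply: eq_bigr => m /hk mk.
rewrite /= mevalZ mevalX rmorphM rmorph_prod mulrCA; congr (_ * _).
have -> : k = (\sum_i m i)%N by rewrite -mdegE -mk.
rewrite -prodrXr -big_split /=; apply: eq_bigr => i _.
by rewrite exprMn rmorphXn.
Qed.

(** * Coordinate changes *)

Lemma mpoly_rmorph_ext n (R S : comNzRingType) (phi psi : {rmorphism {mpoly R[n]} -> S}) :
  (forall a, phi a%:MP = psi a%:MP) -> (forall i, phi 'X_i = psi 'X_i) -> phi =1 psi.
Proof.
move=> eC eX p; rewrite (mpolyE p) !rmorph_sum; apply: eq_bigr => m _.
rewrite -mul_mpolyC !rmorphM eC mpolyXE_id !rmorph_prod; congr (_ * _).
by apply: eq_bigr => i _; rewrite !rmorphXn eX.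
Qed.

Lemma poly_rmorph_ext (R S : nzRingType) (phi psi : {rmorphism {poly R} -> S}) :
  (forall a, phi a%:P = psi a%:P) -> phi 'X = psi 'X -> phi =1 psi.
Proof.
move=> eC eX p; rewrite -(coefK p) poly_def !rmorph_sum; apply: eq_bigr => i _.
by rewrite -mul_polyC !rmorphM !rmorphXn eC eX.
Qed.

Lemma eval_map_polyC (R : nzRingType) (S : comNzRingType) (phi : {rmorphism R -> S}) x a :
  (horner_eval x \o map_poly phi) a%:P = phi a.
Proof. by rewrite /= /horner_eval map_polyC hornerC. Qed.

Lemma eval_map_polyX (R : nzRingType) (S : comNzRingType) (phi : {rmorphism R -> S}) x :
  (horner_eval x \o map_poly phi) 'X = x.
Proof. by rewrite /= /horner_eval map_polyX hornerX. Qed.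

Section Coordinates.
Variable K : fieldType.
Local Notation P3 := {poly {poly {poly K}}}.

(** In the target the outermost variable is X, the middle one Z and the
    innermost one c. *)
Definition to_coords (I : 'I_3 -> P3) : {mpoly K[3]} -> P3 :=
  mmap (polyC \o (polyC \o polyC)) I.
HB.instance Definition _ I := GRing.RMorphism.on (to_coords I).

Definition of_coords (LX LY LZ : {mpoly K[3]}) : P3 -> {mpoly K[3]} :=
  horner_eval LX \o map_poly (horner_eval LZ \o map_poly (horner_eval LY \o map_poly (@mpolyC 3 K))).
HB.instance Definition _ LX LY LZ := GRing.RMorphism.on (of_coords LX LY LZ).

Lemma to_coordsC I a : to_coords I a%:MP = a%:P%:P%:P.
Proof. by rewrite /to_coords mmapC. Qed.

Lemma to_coordsX I i : to_coords I 'X_i = I i.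
Proof. by rewrite /to_coords mmapX mmap1U. Qed.

Lemma of_coordsC LX LY LZ a : of_coords LX LY LZ a%:P%:P%:P = a%:MP.
Proof. by do 3!apply: etrans (eval_map_polyC _ _ _) _. Qed.

Lemma of_coordsX LX LY LZ : of_coords LX LY LZ 'X = LX.
Proof. exact: eval_map_polyX. Qed.

Lemma of_coordsZ LX LY LZ : of_coords LX LY LZ 'X%:P = LZ.
Proof. by apply: etrans (eval_map_polyC _ _ _) _; apply: eval_map_polyX. Qed.

Lemma of_coordsY LX LY LZ : of_coords LX LY LZ 'X%:P%:P = LY.
Proof. by do 2!apply: etrans (eval_map_polyC _ _ _) _; apply: eval_map_polyX. Qed.

Lemma of_coordsK I LX LY LZ :
  (forall i, of_coords LX LY LZ (I i) = 'X_i) ->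
  cancel (to_coords I) (of_coords LX LY LZ).
Proof.
move=> hI; apply: (mpoly_rmorph_ext (phi := of_coords LX LY LZ \o to_coords I) (psi := idfun)).
  by move=> a; rewrite /= to_coordsC of_coordsC.
by move=> i; rewrite /= to_coordsX hI.
Qed.

Lemma to_coordsK I LX LY LZ :
  to_coords I LX = 'X -> to_coords I LY = 'X%:P%:P -> to_coords I LZ = 'X%:P ->
  cancel (of_coords LX LY LZ) (to_coords I).
Proof.
move=> hX hY hZ; pose phi := to_coords I \o of_coords LX LY LZ.
apply: (poly_rmorph_ext (phi := phi) (psi := idfun)); last by rewrite /= of_coordsX.
apply: (poly_rmorph_ext (phi := phi \o polyC) (psi := polyC)); last by rewrite /= of_coordsZ.
apply: (poly_rmorph_ext (phi := phi \o (polyC \o polyC)) (psi := polyC \o polyC)).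
  by move=> a; rewrite /= of_coordsC to_coordsC.
by rewrite /= of_coordsY.
Qed.

(** Polynomials over a graded ring, the variable having degree 1. *)
Definition gradedX (R : nzRingType) (F : nat -> R -> Prop) (n : nat) (p : {poly R}) : Prop :=
  forall i, if (i <= n)%N then F (n - i)%N p`_i else p`_i = 0.

Record grading (R : nzRingType) (F : nat -> R -> Prop) : Prop := Grading {
  grading0 : forall n, F n 0;
  grading1 : F 0%N 1;
  gradingD : forall n a c, F n a -> F n c -> F n (a + c);
  gradingM : forall n m a c, F n a -> F m c -> F (n + m)%N (a * c) }.

Section Graded.
Variables (R : nzRingType) (F : nat -> R -> Prop).
Hypothesis FP : grading F.

Lemma grading_sum (I : Type) (r : seq I) (P : pred I) (E : I -> R) n :
  (forall i, P i -> F n (E i)) -> F n (\sum_(i <- r | P i) E i).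
Proof.
move=> h; apply: (big_ind (F n)) => //; first exact: grading0 FP n.
by move=> x y; exact: gradingD.
Qed.

Lemma gradingX n a k : F n a -> F (k * n)%N (a ^+ k).
Proof.
move=> Fa; elim: k => [|k IH]; first exact: (grading1 FP).
by rewrite exprS mulSn; apply: (gradingM FP).
Qed.

Lemma gradedX_grading : grading (gradedX F).
Proof.
split.
- by move=> n i; rewrite coef0; case: ifP => // _; apply: (grading0 FP).
- by move=> i; rewrite coef1; case: i => [|i] //=; apply: (grading1 FP).
- by move=> n p q hp hq i; have := hp i; have := hq i; rewrite coefD;
    case: ifP => _ => [hp' hq'|-> ->]; [apply: (gradingD FP) | rewrite addr0].
- move=> n m p q hp hq i; rewrite coefM.
  have hF (j : 'I_i.+1) : if (i <= n + m)%N then F (n + m - i)%N (p`_j * q`_(i - j))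
                          else p`_j * q`_(i - j) = 0.
    have hpj := hp j; have hqj := hq (i - j)%N.
    move: hqj; case: ifP => h1 => [hq'|->]; last first.
      by rewrite mulr0; case: ifP => // _; apply: (grading0 FP).
    move: hpj; case: ifP => h2 => [hp'|->]; last first.
      by rewrite mul0r; case: ifP => // _; apply: (grading0 FP).
    have ji := ltn_ord j; case: ifP => h3; last by lia.
    have -> : (n + m - i = (n - j) + (m - (i - j)))%N by lia.
    exact: (gradingM FP).
  case: ifP => h; first by apply: grading_sum => j _; have := hF j; rewrite h.
  by rewrite big1 // => j _; have := hF j; rewrite h.
Qed.

Lemma gradedX_var : gradedX F 1 'X.
Proof.
move=> i; rewrite coefX; case: i => [|[|i]] //=; [exact: (grading0 FP) | exact: (grading1 FP)].
Qed.

Lemma gradedX_const n a : F n a -> gradedX F n a%:P.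
Proof.
move=> Fa i; rewrite coefC; case: i => [|i] /=; first by rewrite subn0.
by case: ifP => // _; apply: (grading0 FP).
Qed.

Lemma gradedX_coef n p i : (i <= n)%N -> gradedX F n p -> F (n - i)%N p`_i.
Proof. by move=> hi /(_ i); rewrite hi. Qed.

Lemma gradedX_coef0 n p i : (n < i)%N -> gradedX F n p -> p`_i = 0.
Proof. by move=> hi /(_ i); rewrite leqNgt hi. Qed.

End Graded.

Definition constants_deg0 (R : nzRingType) (n : nat) (a : R) : Prop := n = 0%N \/ a = 0.

Lemma constants_deg0_grading (R : nzRingType) : grading (@constants_deg0 R).
Proof.
split; rewrite /constants_deg0.
- by right.
- by left.
- by move=> n a c [->|->] [h|->]; rewrite ?add0r; by [left|right|].
- by move=> n m a c [->|->]; [case=> [->|->]; [left|right; rewrite mulr0] | right; rewrite mul0r].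
Qed.

End Coordinates.

(** * The surface in adapted coordinates *)

Section InCoordinates.
Variable K : fieldType.
Local Notation P3 := {poly {poly {poly K}}}.

Let H1 := gradedX (@constants_deg0 K).
Let H2 := gradedX H1.
(** Forms of degree n in X, Z and c. *)
Definition is_form : nat -> P3 -> Prop := gradedX H2.

Let H1P : grading H1 := gradedX_grading (constants_deg0_grading K).
Let H2P : grading H2 := gradedX_grading H1P.
Lemma is_form_grading : grading is_form.
Proof. exact: gradedX_grading H2P. Qed.

Lemma is_formC a : is_form 0 a%:P%:P%:P.
Proof.
apply: (gradedX_const H2P); apply: (gradedX_const H1P).
by apply: (gradedX_const (constants_deg0_grading K)); left.
Qed.

Lemma is_form_X : is_form 1 'X.
Proof. exact: gradedX_var H2P. Qed.

Lemma is_form_Z : is_form 1 'X%:P.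
Proof. apply: (gradedX_const H2P); exact: gradedX_var H1P. Qed.

Lemma is_form_Y : is_form 1 'X%:P%:P.
Proof.
apply: (gradedX_const H2P); apply: (gradedX_const H1P).
exact: gradedX_var (constants_deg0_grading K).
Qed.

Lemma to_coords_form I n p :
  (forall i, is_form 1 (I i)) -> p \is n.-homog -> is_form n (to_coords I p).
Proof.
move=> hI /dhomogP pn; rewrite /to_coords /mmap big_seq; apply: (grading_sum is_form_grading) => m /pn mn.
rewrite -[n]add0n; apply: (gradingM is_form_grading); first exact: is_formC.
have -> : n = (\sum_i m i)%N by rewrite -mdegE -mn.
rewrite /mmap1; elim/big_rec2: _ => [|i y z _ IH]; first exact: (grading1 is_form_grading).
by apply: (gradingM is_form_grading) => //; rewrite -[X in is_form X]muln1; apply: (gradingX is_form_grading).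
Qed.

Lemma form_coef n (p : P3) i j : is_form n p -> (n < i + j)%N -> p`_i`_j = 0.
Proof.
move=> pn nij; case: (leqP i n) => hi; last by rewrite (gradedX_coef0 hi pn) coef0.
by have := gradedX_coef hi pn; apply: gradedX_coef0; lia.
Qed.

(** Values at the point X = c = 0, Z = 1. *)
Definition at_infinity (p : P3) : K := p.[0].[1].[0].

(** At this point only the monomial Z^n does not vanish. *)
Lemma form_at_infinity n (p : P3) : is_form n p -> at_infinity p = p`_0`_n`_0.
Proof.
move=> pn; have p0 : H2 n p`_0 by have := gradedX_coef (leq0n n) pn; rewrite subn0.
rewrite /at_infinity !horner_coef0 (horner_coef_wide _ (leq_maxr n.+1 _)) coef_sum.
have hn : (n < maxn n.+1 (size (p`_0)%R))%N by rewrite leq_max leqnn.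
rewrite (bigD1 (Ordinal hn)) //= expr1n mulr1 big1 ?addr0 // => j jn; rewrite expr1n mulr1.
case: (ltngtP j n) => h; last by case/eqP: jn; apply: val_inj.
  have := gradedX_coef (ltnW h) p0 => /(gradedX_coef (leq0n _)); rewrite subn0.
  by case=> //; lia.
by rewrite (gradedX_coef0 h p0) coef0.
Qed.

Lemma to_coords_at_infinity I p :
  at_infinity (to_coords I p) = p.@[fun i => at_infinity (I i)].
Proof.
pose ev := horner_eval 0 \o (horner_eval 1 \o horner_eval 0) : P3 -> K.
apply: (mpoly_rmorph_ext (phi := ev \o to_coords I) (psi := meval _)).
  by move=> a; rewrite /= to_coordsC mevalC /horner_eval !hornerC.
by move=> i; rewrite /= to_coordsX mevalXU.
Qed.

Variables (f : {mpoly K[3]}) (d : nat) (D : idomainType).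
Variable (pi : {rmorphism {mpoly K[3]} -> D}).
Variables (I : 'I_3 -> P3) (LX LY LZ g2 : {mpoly K[3]}).

(** The coefficient of Z^(d-1) is c times the value of g2 at infinity plus a
    constant from the part of degree d - 1, hence a nonzero polynomial in c;
    this makes [branch_prime_chain] applicable. *)
Theorem prime_chain_in_coords :
  is_quotient_by f pi -> (0 < d)%N -> msize f = d.+1 ->
  (forall i, is_form 1 (I i)) -> (forall i, of_coords LX LY LZ (I i) = 'X_i) ->
  to_coords I LX = 'X -> to_coords I LY = 'X%:P%:P -> to_coords I LZ = 'X%:P ->
  pihomog mdeg d f = LX ^+ d + LY * g2 -> g2 \is d.-1.-homog ->
  g2.@[fun i => at_infinity (I i)] != 0 ->
  exists P : nat -> {pred recip_compl D}, prime_chain 2 P.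
Proof.
move=> [pis pik] d0 fd hI hof hX hY hZ fdE g2h g2P.
have ofK := of_coordsK hof; have toK := to_coordsK hX hY hZ.
pose F := to_coords I f; pose G := to_coords I g2.
have Gf : is_form d.-1 G by apply: to_coords_form.
pose low := \sum_(k < d) to_coords I (pihomog mdeg k f).
have FE : F = 'X^d + 'X%:P%:P * G + low.
  rewrite /F [in LHS](pihomog_partitionE (mf := mdeg) (k := d.+1) (p := f)) ?fd //.
  rewrite rmorph_sum big_ord_recr /= addrC; congr (_ + _).
  by rewrite fdE rmorphD rmorphM rmorphXn /= hX hY.
have lowE i j : (d <= i + j)%N -> low`_i`_j = 0.
  move=> dij; rewrite /low coef_sum coef_sum big1 // => k _.
  apply: form_coef (to_coords_form hI (pihomogP _ _ _)) _.
  exact: leq_trans (ltn_ord k) dij.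
have FijE i j : (d <= i + j)%N -> F`_i`_j = ((i == d) && (j == 0%N))%:R.
  move=> dij; rewrite FE !coefD lowE // addr0 coefCM coefCM.
  rewrite (form_coef Gf) ?mulr0 ?addr0; last by lia.
  by rewrite coefXn; case: eqP => _ /=; rewrite ?coef0 // coef1.
have Fcoef_d : F`_d = 1.
  by apply/polyP => j; rewrite FijE ?leq_addr // eqxx coef1.
have F_size : size F = d.+1.
  apply/eqP; rewrite eqn_leq; apply/andP; split.
    apply/leq_sizeP => i di; apply/polyP => j; rewrite FijE; last by lia.
    by rewrite coef0 gtn_eqF.
  by rewrite ltnNge; apply/negP => /leq_sizeP/(_ d (leqnn _))/eqP; rewrite Fcoef_d oner_eq0.
have F_monic : F \is monic by apply/monicP; rewrite /lead_coef F_size.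
have F_low i j : (i < d)%N -> (d <= i + j)%N -> F`_i`_j = 0.
  by move=> id dij; rewrite FijE // ltn_eqF.
have b0 : - F`_0`_(d.-1) != 0.
  rewrite oppr_eq0; apply: contra_neq g2P => F0.
  rewrite -to_coords_at_infinity -/G (form_at_infinity Gf).
  move: F0 => /(congr1 (fun q : {poly K} => q`_1)).
  rewrite FE !coefD coefCM coefCM coefXn coefXM /= (ltn_eqF d0) !coef0 add0r.
  suff -> : low`_0`_(d.-1)`_1 = 0 by rewrite addr0.
  rewrite /low !coef_sum big1 // => k _.
  have Lf := to_coords_form hI (pihomogP mdeg k f).
  have [dk|kd] := leqP d.-1 k; last by rewrite (form_coef Lf) ?coef0 //.
  have kE : (k = d.-1 :> nat) by have := ltn_ord k; lia.
  have := gradedX_coef (leq0n _) Lf => /(gradedX_coef (_ : d.-1 <= k - 0)%N).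
  rewrite subn0 kE subnn => /(_ (leqnn _)).
  by move/(gradedX_coef0 (ltn0Sn 0)).
apply: (@branch_prime_chain K d F d0 F_monic F_size F_low b0 D (pi \o of_coords LX LY LZ)).
split.
  by move=> y; have [x <-] := pis y; exists (to_coords I x); rewrite /= ofK.
move=> h; split.
  move/pik => [q hq]; exists (to_coords I q); by rewrite -rmorphM -hq; apply/esym/toK.
case=> q ->; apply/pik; exists (of_coords LX LY LZ q).
by rewrite rmorphM; congr (_ * _); apply: ofK.
Qed.
End InCoordinates.

(** * Choosing the coordinates *)

Section LinearCoordinates.
Variable K : fieldType.
Local Notation P3 := {poly {poly {poly K}}}.

Lemma is_formD n (p q : P3) : is_form n p -> is_form n q -> is_form n (p + q).
Proof. exact: (gradingD (@is_form_grading K)). Qed.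

Lemma is_formZ n (a : K) (p : P3) : is_form n p -> is_form n (a%:P%:P%:P * p).
Proof. by move=> pn; have := gradingM (@is_form_grading K) (is_formC a) pn. Qed.

Lemma dhomog1_sum (g : {mpoly K[3]}) :
  g \is 1.-homog -> g = \sum_(i < 3) g@_U_(i) *: 'X_i.
Proof.
move=> /dhomogP gh; apply/mpolyP => m; rewrite raddf_sum /=.
have [/mdeg1P[i /eqP ->]|m1] := boolP (mdeg m == 1%N).
  rewrite (bigD1 i) //= mcoeffZ mcoeffX eqxx mulr1 big1 ?addr0 // => j ji.
  rewrite mcoeffZ mcoeffX; case: eqP => [e|]; last by rewrite mulr0.
  by move/(congr1 (fun m : 'X_{1..3} => m i)): e; rewrite !mnm1E eqxx (negPf ji).
rewrite big1 => [|i _]; first by apply: memN_msupp_eq0; apply: contra m1 => /gh ->.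
rewrite mcoeffZ mcoeffX; case: eqP => [e|]; last by rewrite mulr0.
by case/eqP: m1; rewrite -e mdeg1.
Qed.

Lemma unit_msize (u : {mpoly K[3]}) : u \is a GRing.unit -> msize u = 1%N.
Proof.
move=> hu; have u0 : u != 0 by apply: contraTneq hu => ->; rewrite unitr0.
have : msize (u * u^-1) = 1%N by rewrite divrr // msize1.
have v0 : u^-1 != 0 by rewrite invr_eq0.
have : (0 < msize u)%N by rewrite lt0n msize_poly_eq0.
have : (0 < msize (u^-1)%R)%N by rewrite lt0n msize_poly_eq0.
by rewrite msizeM //; move: (mmeasure _ u) (mmeasure _ (u^-1)) => a b; lia.
Qed.

Lemma dhomog_msizeE n (h : {mpoly K[3]}) : h \is n.-homog -> h != 0 -> msize h = n.+1.
Proof.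
by move=> /dhomogP hn h0; rewrite -mlead_deg //; congr _.+1; apply: hn; apply: mlead_supp.
Qed.

(** A K-rational point is fixed by the automorphisms over K, so that its class
    consists of multiples of one vector. *)
Lemma rational_point_Vbar (L : closedFieldType) (iota : {rmorphism K -> L})
    (h : {mpoly K[3]}) n (v : 'I_3 -> K) :
  h \is n.-homog -> h.@[v] = 0 -> (exists i, v i != 0) ->
  Vbar iota h [set w | same_point iota (\row_i iota (v i)) w]%classic.
Proof.
move=> hn hv [i vi]; split.
  exists (\row_i iota (v i)) => //; apply: contra_neq vi => /rowP/(_ i).
  by rewrite !mxE => /eqP; rewrite fmorph_eq0 => /eqP.
move=> w [c [sigma [c0 _ sK ->]]].
under meval_eq => j do rewrite !mxE sK.
by rewrite (mmap_homog_scale iota v c hn) hv rmorph0 mulr0.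
Qed.

Lemma rmorph_line (S U : comNzRingType) (phi : {rmorphism S -> U}) (a b c x y z : S)
    (a' b' c' x' y' z' : U) :
  phi a = a' -> phi b = b' -> phi c = c' -> phi x = x' -> phi y = y' -> phi z = z' ->
  phi (a * x + b * y + c * z) = a' * x' + b' * y' + c' * z'.
Proof. by move=> <- <- <- <- <- <-; rewrite !rmorphD !rmorphM. Qed.

Lemma rmorph_line_coord (S U : comNzRingType) (phi : {rmorphism S -> U}) (a b c x y z : S)
    (a' b' c' x' y' z' : U) :
  phi a = a' -> phi b = b' -> phi c = c' -> phi x = x' -> phi y = y' -> phi z = z' ->
  phi (a * (y + b * x + c * z)) = a' * (y' + b' * x' + c' * z').
Proof. by move=> <- <- <- <- <- <-; rewrite rmorphM !rmorphD !rmorphM. Qed.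

Lemma rmorph_mulfV (F : fieldType) (S : comNzRingType) (phi : {rmorphism F -> S}) a :
  a != 0 -> phi a * phi a^-1 = 1.
Proof. by move=> a0; rewrite -rmorphM mulfV // rmorph1. Qed.

Lemma rmorph_mulVf (F : fieldType) (S : comNzRingType) (phi : {rmorphism F -> S}) a :
  a != 0 -> phi a^-1 * phi a = 1.
Proof. by move=> a0; rewrite mulrC rmorph_mulfV. Qed.

Lemma linear_solve_coord (S : comNzRingType) (x t z e a f a' : S) : a' * a = 1 ->
  a' * (e * x + a * t + f * z + - e * x + - f * z) = t.
Proof. by move=> h; rewrite -[RHS]mul1r -h; ring. Qed.

Lemma linear_solve_value (S : comNzRingType) (x y z e a f a' : S) : a * a' = 1 ->
  e * x + a * (a' * (y + - e * x + - f * z)) + f * z = y.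
Proof. by move=> h; rewrite mulrA h; ring. Qed.

Section TangentLine.
Variables (j k : 'I_3) (e0 ej ek : K).
Hypotheses (j0 : j != ord0) (k0 : k != ord0) (kj : k != j) (ej0 : ej != 0).

Definition tangent_line : {mpoly K[3]} := e0 *: 'X_ord0 + ej *: 'X_j + ek *: 'X_k.

(** The substitution inverse to X = X_0, c = tangent_line, Z = X_k. *)
Definition tangent_coords (i : 'I_3) : P3 :=
  if i == ord0 then 'X else if i == k then 'X%:P
  else (ej^-1)%:P%:P%:P * ('X%:P%:P + (- e0)%:P%:P%:P * 'X + (- ek)%:P%:P%:P * 'X%:P).

Lemma ord3_cases (i : 'I_3) : [\/ i = ord0, i = k | i = j].
Proof.
move: j0 k0 kj; case: i => [[|[|[|//]]] hi]; case: j => [[|[|[|//]]] hj] //;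
  case: k => [[|[|[|//]]] hk] // _ _ _;
  by [left; apply: val_inj | right; left; apply: val_inj
     | constructor 1; apply: val_inj | constructor 2; apply: val_inj | constructor 3; apply: val_inj].
Qed.

Lemma tangent_coords_j :
  tangent_coords j = (ej^-1)%:P%:P%:P * ('X%:P%:P + (- e0)%:P%:P%:P * 'X + (- ek)%:P%:P%:P * 'X%:P).
Proof. by rewrite /tangent_coords (negPf j0) eq_sym (negPf kj). Qed.

Lemma tangent_coords_k : tangent_coords k = 'X%:P.
Proof. by rewrite /tangent_coords (negPf k0) eqxx. Qed.

Lemma tangent_coords_form i : is_form 1 (tangent_coords i).
Proof.
rewrite /tangent_coords; case: ifP => _; first exact: is_form_X.
case: ifP => _; first exact: is_form_Z.
apply: is_formZ; apply: is_formD; first apply: is_formD; first exact: is_form_Y.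
  exact: is_formZ (is_form_X _).
exact: is_formZ (is_form_Z _).
Qed.

Lemma rmorph_tangent_coords (phi : {rmorphism P3 -> {mpoly K[3]}}) i :
  (forall a, phi a%:P%:P%:P = a%:MP) -> phi 'X = 'X_ord0 -> phi 'X%:P%:P = tangent_line ->
  phi 'X%:P = 'X_k -> phi (tangent_coords i) = 'X_i.
Proof.
move=> hC hX hY hZ; case: (ord3_cases i) => ->; rewrite ?tangent_coords_j ?tangent_coords_k //.
apply: etrans (rmorph_line_coord (hC _) (hC _) (hC _) hX hY hZ) _.
rewrite /tangent_line -!mul_mpolyC !mpolyCN.
have ea := rmorph_mulVf (mpolyC 3 (R := K)) ej0.
exact: (linear_solve_coord _ _ _ _ _ ea).
Qed.

Lemma rmorph_tangent_line (psi : {rmorphism {mpoly K[3]} -> P3}) :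
  (forall a, psi a%:MP = a%:P%:P%:P) -> (forall i, psi 'X_i = tangent_coords i) ->
  psi tangent_line = 'X%:P%:P.
Proof.
move=> hC hX; rewrite /tangent_line -!mul_mpolyC.
have hX0 : psi 'X_ord0 = 'X by rewrite hX /tangent_coords eqxx.
have hXj := etrans (hX j) tangent_coords_j; have hXk := etrans (hX k) tangent_coords_k.
apply: etrans (rmorph_line (hC _) (hC _) (hC _) hX0 hXj hXk) _.
rewrite !polyCN.
pose const : {rmorphism K -> P3} := polyC \o (polyC \o polyC).
have ea : ej%:P%:P%:P * (ej^-1)%:P%:P%:P = 1 :> P3 := rmorph_mulfV const ej0.
exact: (linear_solve_value _ _ _ _ _ ea).
Qed.

Lemma of_tangent_coords i :
  of_coords 'X_ord0 tangent_line 'X_k (tangent_coords i) = 'X_i.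
Proof.
apply: (rmorph_tangent_coords (phi := of_coords 'X_ord0 tangent_line 'X_k)).
- exact: of_coordsC.
- exact: of_coordsX.
- exact: of_coordsY.
- exact: of_coordsZ.
Qed.

Lemma to_tangent_line : to_coords tangent_coords tangent_line = 'X%:P%:P.
Proof.
apply: (rmorph_tangent_line (psi := to_coords tangent_coords)).
- exact: to_coordsC.
- exact: to_coordsX.
Qed.

(** The coordinates X and c vanish at the rational point that the line and
    the plane X = 0 have in common, and Z = 1 there. *)
Lemma tangent_point : exists v : 'I_3 -> K,
  [/\ forall i, at_infinity (tangent_coords i) = v i, v ord0 = 0, v k = 1
     & tangent_line.@[v] = 0].
Proof.
exists (fun i => at_infinity (tangent_coords i)).
have v0 : at_infinity (tangent_coords ord0) = 0.
  by rewrite /tangent_coords eqxx /at_infinity !(hornerX, hornerC).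
have vk : at_infinity (tangent_coords k) = 1.
  by rewrite tangent_coords_k /at_infinity !(hornerX, hornerC).
split=> //; rewrite -to_coords_at_infinity to_tangent_line.
by rewrite /at_infinity !(hornerX, hornerC).
Qed.

End TangentLine.

End LinearCoordinates.

(** * The two kinds of equations *)

Section Cases.
Variables (K : fieldType) (f : {mpoly K[3]}) (d : nat) (D : idomainType).
Variable (pi : {rmorphism {mpoly K[3]} -> D}).
Hypotheses (piP : is_quotient_by f pi) (d0 : (0 < d)%N) (fd : msize f = d.+1).
Local Notation P3 := {poly {poly {poly K}}}.

Lemma prime_chain_tangent (j k : 'I_3) (e0 ej ek : K) (g2 : {mpoly K[3]}) :
  j != ord0 -> k != ord0 -> k != j -> ej != 0 -> g2 \is d.-1.-homog ->
  pihomog mdeg d f = 'X_ord0 ^+ d + tangent_line j k e0 ej ek * g2 ->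
  (forall v : 'I_3 -> K, v ord0 = 0 -> v k = 1 ->
     (tangent_line j k e0 ej ek).@[v] = 0 -> g2.@[v] != 0) ->
  exists P : nat -> {pred recip_compl D}, prime_chain 2 P.
Proof.
move=> j0 k0 kj ej0 g2h fdE g2P.
have [v [vE v0 vk vt]] := tangent_point e0 ek j0 k0 kj ej0.
apply: (@prime_chain_in_coords K f d D pi (tangent_coords k e0 ej ek)
  'X_ord0 (tangent_line j k e0 ej ek) 'X_k g2) => //.
- exact: tangent_coords_form.
- exact: of_tangent_coords.
- by rewrite to_coordsX /tangent_coords eqxx.
- exact: to_tangent_line.
- by rewrite to_coordsX tangent_coords_k.
by rewrite (meval_eq _ vE); apply: g2P.
Qed.

(** The form a X_0 is written as (a X_0 - X_1) + X_1: then X_1 is in the place of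
    g1 and 1 in that of g2. *)
Lemma prime_chain_hyperplane (a : K) :
  d = 1%N -> a != 0 -> pihomog mdeg d f = a *: 'X_ord0 ->
  exists P : nat -> {pred recip_compl D}, prime_chain 2 P.
Proof.
move=> d1 a0 fdE.
pose j : 'I_3 := lift ord0 ord0; pose k : 'I_3 := lift ord0 (lift ord0 ord0).
pose I (i : 'I_3) : P3 :=
  if i == ord0 then (a^-1)%:P%:P%:P * ('X + 'X%:P%:P) else if i == k then 'X%:P else 'X%:P%:P.
have I0 : I ord0 = (a^-1)%:P%:P%:P * ('X + 'X%:P%:P) by [].
have Ij : I j = 'X%:P%:P by [].
have Ik : I k = 'X%:P by [].
have cases (i : 'I_3) : [\/ i = ord0, i = j | i = k].
  by case: i => [[|[|[|//]]] hi]; [constructor 1|constructor 2|constructor 3]; apply: val_inj.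
pose LX : {mpoly K[3]} := a%:MP * 'X_ord0 - 'X_j.
apply: (@prime_chain_in_coords K f d D pi I LX 'X_j 'X_k 1) => //.
- move=> i; case: (cases i) => ->; rewrite ?I0 ?Ij ?Ik.
  + apply: is_formZ; apply: is_formD; [exact: is_form_X|exact: is_form_Y].
  + exact: is_form_Y.
  + exact: is_form_Z.
- move=> i; case: (cases i) => ->; rewrite ?I0 ?Ij ?Ik.
  + have E (phi : {rmorphism P3 -> {mpoly K[3]}}) x y z x' y' z' :
        phi x = x' -> phi y = y' -> phi z = z' -> phi (x * (y + z)) = x' * (y' + z').
      by move=> <- <- <-; rewrite rmorphM rmorphD.
    apply: etrans (E (of_coords LX 'X_j 'X_k) _ _ _ _ _ _
      (of_coordsC _ _ _ _) (of_coordsX _ _ _) (of_coordsY _ _ _)) _.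
    rewrite subrK mulrA.
    by rewrite (rmorph_mulVf (mpolyC 3 (R := K)) a0) mul1r.
  + exact: of_coordsY.
  + exact: of_coordsZ.
- have E (phi : {rmorphism {mpoly K[3]} -> P3}) x y z x' y' z' :
      phi x = x' -> phi y = y' -> phi z = z' -> phi (x * y - z) = x' * y' - z'.
    by move=> <- <- <-; rewrite rmorphB rmorphM.
  apply: etrans (E (to_coords I) _ _ _ _ _ _
    (to_coordsC _ _) (to_coordsX _ _) (to_coordsX _ _)) _.
  rewrite I0 Ij.
  pose const : {rmorphism K -> P3} := polyC \o (polyC \o polyC).
  have ea : a%:P%:P%:P * (a^-1)%:P%:P%:P = 1 :> P3 := rmorph_mulfV const a0.
  by rewrite mulrA ea mul1r addrK.
- by rewrite to_coordsX.
- by rewrite to_coordsX.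
- by rewrite fdE d1 expr1 mulr1 /LX subrK mul_mpolyC.
- by rewrite d1 dhomog1.
by rewrite meval1 oner_eq0.
Qed.
End Cases.

Theorem proposition6p4 (K : fieldType) (p : nat) (f : {mpoly K[3]}) (d : nat)
  (L : closedFieldType) (iota : {rmorphism K -> L})
  (D : idomainType) (pi : {rmorphism {mpoly K[3]} -> D})
  (g g1 g2 : {mpoly K[3]}) :
  characteristic K p ->
  is_algebraic_closure iota ->
  is_quotient_by f pi ->
  irreducible f ->
  msize f = d.+1 ->
  ~~ (p %| d)%N ->
  irreducible (pihomog mdeg d f) ->
  pihomog mdeg d f = 'X_ord0 ^+ d + g ->
  g != 0 ->
  g = g1 * g2 ->
  msize g1 = 2%N ->
  g1 != 'X_ord0 ->
  (Vbar iota g1 `&` Vbar iota g2 `&` Vbar iota (pihomog mdeg d f) = set0)%classic ->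
  has_krull_dim (recip_compl D) 2.
Proof.
move=> _ _ piP [f0 _ _] fd pd irr fdE g0 gE g1s _ V0.
have d0 : (0 < d)%N by rewrite lt0n; apply: contraNneq pd => ->; apply: dvdn0.
split; last exact: recip_compl_prime_chain_le2 f0 piP.
have fdh : pihomog mdeg d f \is d.-homog by apply: pihomogP.
have X1 : 'X_ord0 \is [in K[3], 1.-homog] by rewrite dhomogX /= mdeg1.
have gh : g \is d.-homog.
  have -> : g = pihomog mdeg d f - 'X_ord0 ^+ d by rewrite fdE addrC addKr.
  by rewrite rpredB //; have := dhomogMn d X1; rewrite mul1n.
have [g10 g20] : g1 != 0 /\ g2 != 0 by apply/andP; rewrite -negb_or -mulf_eq0 -gE.
have g1h : g1 \is 1.-homog.
  by have := dhomog_factor (p := g1) (q := g2) (d := d); rewrite -gE g1s; apply.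
have g2h : g2 \is d.-1.-homog.
  have := dhomog_factor (p := g2) (q := g1) (d := d); rewrite mulrC -gE => /(_ gh g0).
  have := dhomog_msizeE gh g0; rewrite gE msizeM // g1s /=.
  by move: (mmeasure _ g2) => m; rewrite add1n => -[<-].
have tangent (j k : 'I_3) : j != ord0 -> k != ord0 -> k != j -> g1@_U_(j) != 0 ->
    g1 = tangent_line j k g1@_U_(ord0) g1@_U_(j) g1@_U_(k) ->
    exists P : nat -> {pred recip_compl D}, prime_chain 2 P.
  move=> j0 k0 kj ej0 g1E.
  apply: (prime_chain_tangent (e0 := g1@_U_(ord0)) (ek := g1@_U_(k)) piP d0 fd j0 k0 kj ej0 g2h).
    by rewrite -g1E -gE.
  rewrite -g1E => v v0 vk v1; apply: contra_eq_neq V0 => v2.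
  have vn0 : exists i, v i != 0 by exists k; rewrite vk oner_eq0.
  (* The point v would lie in the intersection assumed to be empty. *)
  apply/set0P; exists [set w | same_point iota (\row_i iota (v i)) w]%classic.
  split; first split.
  - exact: rational_point_Vbar g1h v1 vn0.
  - exact: rational_point_Vbar g2h v2 vn0.
  apply: rational_point_Vbar fdh _ vn0.
  by rewrite fdE gE mevalD mevalM v1 mul0r addr0 rmorphXn /= mevalXU v0 expr0n gtn_eqF.
have g1E := dhomog1_sum g1h; rewrite !big_ord_recl big_ord0 addr0 in g1E.
set j1 : 'I_3 := lift ord0 ord0 in g1E; set j2 : 'I_3 := lift ord0 (lift ord0 ord0) in g1E.
have [e1|e1] := eqVneq g1@_U_(j1) 0; last by apply: (tangent j1 j2); rewrite // /tangent_line -addrA.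
have [e2|e2] := eqVneq g1@_U_(j2) 0; last first.
  by apply: (tangent j2 j1); rewrite // /tangent_line -addrA [X in _ + X]addrC.
(* Now g1 is a multiple of X_0, hence f_d is too, and it is irreducible only
   if its other factor is constant, so that d = 1. *)
rewrite e1 e2 !scale0r !addr0 in g1E.
set e := g1@_U_(ord0) in g1E.
have fX : pihomog mdeg d f = 'X_ord0 * ('X_ord0 ^+ d.-1 + e *: g2).
  by rewrite fdE gE g1E mulrDr -exprS prednK // -scalerAl -scalerAr.
case: irr => fd0 _ /(_ _ _ fX) irr.
have := dhomog_msizeE fdh fd0.
have [q0 X0] : 'X_ord0 ^+ d.-1 + e *: g2 != 0 /\ 'X_ord0 != 0 :> {mpoly K[3]}.
  by apply/andP; rewrite andbC -negb_or -mulf_eq0 -fX.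
rewrite [in msize _]fX msizeM // msizeX mdeg1.
case: irr => /unit_msize hu; first by move: hu; rewrite msizeX /= mdeg1.
rewrite hu => -[d1].
have [c g2E] : exists c, g2 = c%:MP.
  by exists g2@_0; apply: msize1_polyC; rewrite (dhomog_msizeE g2h g20) -d1.
have fd1 : pihomog mdeg d f = (1 + e * c) *: 'X_ord0.
  rewrite fX g2E -d1 expr0 -mul_mpolyC -mpolyCM -mpolyC1 -mpolyCD mulrC mul_mpolyC //.
apply: (prime_chain_hyperplane piP d0 fd (esym d1) _ fd1).
by apply: contra_neq fd0 => h; rewrite fd1 h scale0r.
Qed.
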